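(* Let $T>0$ and let $x:[0,T]\to\mathbb{R}$ be a càdlàg function. Let $(\pi^n)_{n\in\mathbb{N}}$ be a sequence of partitions of $(0,T]$ satisfying, with respect to $x$, the assumptions (A1) and (A2) spelled out in the context. Let $[x]:[0,T]\to[0,+\infty)$, $t\mapsto[x]_t$, be a non-decreasing function such that for every $t\in[0,T]$ at which $[x]$ is continuous, for $t=T$, and for every $t\in(0,T]$ at which $x$ has a jump, the following limit exists and $$\lim_{n\to+\infty}\sum_{(u,v]\in\pi^n}\left(x(v\wedge t)-x(u\wedge t)\right)^2=[x]_t .$$ Assume moreover that $[x]$ is right-continuous at all points $t\in(0,T)$ where $x$ has jumps. Let $\widetilde{[x]}$ denote the right-continuous modification of $[x]$. Then for any twice continuously differentiable $f:\mathbb{R}\to\mathbb{R}$, the limit $\lim_{n\to+\infty}\sum_{(u,v]\in\pi^n}f''(x(u))(x(v)-x(u))^2$ may be expressed as the Lebesgue–Stieltjes integral $$\lim_{n\to+\infty}\sum_{(u,v]\in\pi^n}f''(x(u))\left(x(v)-x(u)\right)^2=\int_{(0,T]}f''(x(t-))\,\mathrm{d}\widetilde{[x]}_t,$$ and the Itô–Föllmer formula holds: $$f(x(T))-f(x(0))=\int_{(0,T]}f'(x(t-))\,\mathrm{d}x(t)+\frac12\int_{(0,T]}f''(x(t-))\,\mathrm{d}\widetilde{[x]}_t+J,$$ where $\int_{(0,T]}f'(x(t-))\,\mathrm{d}x(t)$ denotes the limit $$\lim_{n\to+\infty}\sum_{(u,v]\in\pi^n}f'(x(u))\left(x(v)-x(u)\right)$$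 (which exists), and $$J=\sum_{t\in D}\left\{f(x(t))-f(x(t-))-f'(x(t-))\Delta x(t)-\tfrac12 f''(x(t-))\left(\Delta x(t)\right)^2\right\},$$ with $D=\{t\in(0,T]:|\Delta x(t)|>0\}$.
   Context: Càdlàg means right-continuous with left limits. For $t\in(0,T]$, $x(t-)$ is the left limit of $x$ at $t$ and $\Delta x(t):=x(t)-x(t-)$; $x$ has a jump at $t\in(0,T]$ if $\Delta x(t)\neq0$. $a\wedge b$ denotes $\min(a,b)$. A partition of $(0,T]$ is a finite sequence $\pi=\left((t_i,t_{i+1}]\right)_{i=0}^{k-1}$ of intervals with $0=t_0<t_1<\dots<t_k=T$. A sequence of partitions $(\pi^n)_{n\in\mathbb{N}}$ of $(0,T]$ is a sequence in which each $\pi^n$ is a partition of $(0,T]$; no assumption that the mesh tends to $0$ is made, and the partitions need not be nested. For a partition $\pi$ and $s\in(0,T]$, $\underline{\pi}(s):=u$ where $(u,v]$ is the unique interval of $\pi$ containing $s$. For $\varepsilon>0$ put $D(\varepsilon)=\{t\in(0,T]:|\Delta x(t)|\ge\varepsilon\}$ (a finite set) and define $J_\varepsilon(x):[0,T]\to\mathbb{R}$ by $J_\varepsilon(x)(t):=\sum_{s\in D(\varepsilon)\cap[0,t]}\Delta x(s)$. For $y:[0,T]\to\mathbb{R}$ and $A\subseteq[0,T]$ let $\omega(y;A):=\sup_{s,t\in A}|y(t)-y(s)|$, and for a partition $\pi$ of $(0,T]$ let $O(y;\pi):=\max_{(u,v]\in\pi}\omega(y;(u,v])$. The assumptions on $(\pi^n)$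 relative to $x$ are: (A1) $\displaystyle\limsup_{\varepsilon\to0+}\limsup_{n\to+\infty}O\left(x-J_\varepsilon(x);\pi^n\right)=0$. (A2) For any $s\in(0,T]$, $\displaystyle\lim_{n\to+\infty}x\left(\underline{\pi^n}(s)\right)=x(s-)$. The right-continuous modification $\widetilde{[x]}$ of the non-decreasing function $[x]$ is given by $\widetilde{[x]}_t=\lim_{s\downarrow t}[x]_s$ for $t\in[0,T)$ and $\widetilde{[x]}_T=[x]_T$. The integral $\int_{(0,T]}g(t)\,\mathrm{d}\widetilde{[x]}_t$ is the integral of the Borel function $g:(0,T]\to\mathbb{R}$ with respect to the Lebesgue–Stieltjes measure $\tilde\mu$ on $(0,T]$ determined by $\tilde\mu(a,b]=\widetilde{[x]}_b-\widetilde{[x]}_a$ for $0\le a<b\le T$.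
   Formalization: The formal theorem additionally assumes that [x] is right-continuous at 0; without this the claim is false, since the square sums may leave mass at 0+ that the measure on (0,T] does not see (take f(y)=y²). *)

(* Defs.v *)
From HB Require Import structures.
From mathcomp Require Import all_boot all_order all_algebra.
From mathcomp Require Import all_classical all_reals all_analysis.

Set Implicit Arguments.
Unset Strict Implicit.
Unset Printing Implicit Defensive.

Import Order.TTheory GRing.Theory Num.Theory.
Import numFieldNormedType.Exports.

Local Open Scope classical_set_scope.
Local Open Scope ring_scope.

(* Functions on [0, T] are represented by functions R -> R; every notion below
   that takes the horizon T only looks at the values on [0, T].               *)

Section Paths.
Context {R : realType}.
Implicit Types (T t e : R) (x : R -> R).

Definition left_lim x t : R := lim (x s @[s --> t^'-]).

Definition jump x t : R := x t - left_lim x t.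

Definition cadlag T x : Prop :=
  (forall t, 0 <= t < T -> x s @[s --> t^'+] --> x t) /\
  (forall t, 0 < t <= T -> cvg (x s @[s --> t^'-])).

Definition big_jumps T x e : set R := [set t | 0 < t <= T /\ e <= `|jump x t|].

(* For a cadlag x and 0 < e the set of summation is finite; a finitely supported
   sum over an infinite support would be 0 by convention.                     *)
Definition jump_part T x e t : R :=
  \sum_(s \in big_jumps T x e `&` `[0, t]) jump x s.

Definition C2 (f : R -> R) : Prop :=
  [/\ forall y, derivable f y 1,
      forall y, derivable (derive1 f) y 1
    & continuous (derive1n 2 f)].

End Paths.

(* A partition 0 = t_0 < t_1 < ... < t_k = T of (0, T] is encoded by the sequence
   pi = [:: t_1; ...; t_k] such that [itv_partition 0 T pi].                  *)
Section Partitions.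
Context {R : realType}.
Implicit Types (T t : R) (pi : seq R) (x y f : R -> R).

Definition pieces pi : seq (R * R) := zip (0 :: pi) pi.

(* The pair (0, 0) is returned only when no piece contains s. *)
Definition left_endpoint pi (s : R) : R :=
  (head (0, 0) [seq I <- pieces pi | I.1 < s <= I.2]).1.

Definition oscillation y (A : set R) : \bar R :=
  ereal_sup [set (`|y p.2 - y p.1|)%:E | p in A `*` A].

Definition max_oscillation y pi : \bar R :=
  \big[maxe/-oo%E]_(I <- pieces pi) oscillation y `]I.1, I.2].

Definition A1 T x (pi : nat -> seq R) : Prop :=
  limf_esup (fun e : R =>
    limn_esup (fun n => max_oscillation (x \- jump_part T x e) (pi n)))
    (0 : R)^'+ = 0%E.

Definition A2 T x (pi : nat -> seq R) : Prop :=
  forall s, 0 < s <= T ->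
    x (left_endpoint (pi n) s) @[n --> \oo] --> left_lim x s.

Definition square_sum x pi t : R :=
  \sum_(I <- pieces pi) (x (Num.min I.2 t) - x (Num.min I.1 t)) ^+ 2.

Definition first_order_sum f x pi : R :=
  \sum_(I <- pieces pi) derive1 f (x I.1) * (x I.2 - x I.1).

Definition second_order_sum f x pi : R :=
  \sum_(I <- pieces pi) derive1n 2 f (x I.1) * (x I.2 - x I.1) ^+ 2.

Definition follmer_integral f x (pi : nat -> seq R) : R :=
  limn (fun n => first_order_sum f x (pi n)).

End Partitions.

Section JumpSum.
Context {R : realType}.

Definition all_jumps T (x : R -> R) : set R :=
  [set t | 0 < t <= T /\ 0 < `|jump x t|].

Definition ito_jump_term (f x : R -> R) (t : R) : R :=
  f (x t) - f (left_lim x t) - derive1 f (left_lim x t) * jump x t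
    - 2^-1 * derive1n 2 f (left_lim x t) * jump x t ^+ 2.

(* Meaningful when the family g is absolutely summable on D. *)
Definition sum_over (D : set R) (g : R -> R) : R :=
  fine (\esum_(t in D) (g^\+ t)%:E - \esum_(t in D) (g^\- t)%:E)%E.

End JumpSum.

Section RightContinuousModification.
Context {R : realType}.
Implicit Types (T t : R) (q : R -> R).

(* continuity at t of q as a function on the space [0, T] *)
Definition continuous_on_at T q t : Prop :=
  q s @[s --> within `[0, T] (nbhs t)] --> q t.

Definition rc_mod T q t : R :=
  if t < T then lim (q s @[s --> t^'+]) else q T.

(* Extension to R, constant on ]-oo, 0] and on [T, +oo[. *)
Definition rc_mod_ext T q t : R := rc_mod T q (Num.max 0 t).

Section Cumulative.
Variables (T : R) (q : R -> R).
Hypothesis T_gt0 : 0 < T.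
Hypothesis q_nd : {in `[0, T] &, {homo q : a b / a <= b}}.

Let nonempty_image t : t < T -> (q @` `]t, T]) (q T).
Proof. by move=> tT; exists T => //=; rewrite in_itv/= tT lexx. Qed.

Let lbound_image t s : 0 <= t -> t < s <= T -> q t <= q s.
Proof.
move=> t0 /andP[ts sT]; apply: q_nd => //; rewrite ?in_itv/= ?t0 ?sT ?andbT/=.
- by rewrite (le_trans (ltW ts)).
- by rewrite (le_trans t0 (ltW ts)).
- exact: ltW.
Qed.

Let has_lbound_image t : 0 <= t -> has_lbound (q @` `]t, T]).
Proof.
move=> t0; exists (q t) => y [s]; rewrite /= in_itv/= => sT <-.
exact: lbound_image.
Qed.

Lemma rc_mod_inf t : 0 <= t -> t < T -> rc_mod T q t = inf (q @` `]t, T]).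
Proof.
move=> t0 tT; rewrite /rc_mod tT; apply/cvg_lim => //.
apply: (@nondecreasing_at_right_cvgr _ q t (BRight T)).
- by rewrite bnd_simp.
- move=> a b; rewrite !in_itv/= => /andP[ta aT] /andP[tb bT] ab.
  apply: q_nd => //; rewrite in_itv/= ?aT ?bT andbT.
    exact: le_trans t0 (ltW ta).
  exact: le_trans t0 (ltW tb).
- exact: has_lbound_image.
Qed.

Let rc_mod_le t s : 0 <= t -> t < s <= T -> rc_mod T q t <= q s.
Proof.
move=> t0 /andP[ts sT]; rewrite rc_mod_inf// ?(lt_le_trans ts)//.
apply: ge_inf; first exact: has_lbound_image.
by exists s => //=; rewrite in_itv/= ts.
Qed.

Let rc_mod_ge t c : 0 <= t -> t < T -> (forall s, t < s <= T -> c <= q s) ->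
  c <= rc_mod T q t.
Proof.
move=> t0 tT h; rewrite rc_mod_inf//; apply: lb_le_inf.
  by exists (q T); exact: nonempty_image.
by move=> y [s]; rewrite /= in_itv/= => sT <-; exact: h.
Qed.

Let rc_mod_geT t : T <= t -> rc_mod T q t = q T.
Proof. by move=> Tt; rewrite /rc_mod ltNge Tt. Qed.

Let rc_mod_nd s t : 0 <= s -> s <= t -> rc_mod T q s <= rc_mod T q t.
Proof.
move=> s0 st; have [tT|Tt] := ltP t T.
  apply: rc_mod_ge => //; first exact: le_trans st.
  move=> r /andP[tr rT]; apply: rc_mod_le => //.
  by rewrite rT (le_lt_trans st).
rewrite (rc_mod_geT Tt); have [sT|Ts] := ltP s T; last by rewrite rc_mod_geT.
by apply: rc_mod_le => //; rewrite sT lexx.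
Qed.

Lemma rc_mod_ext_nondecreasing : {homo rc_mod_ext T q : s t / s <= t}.
Proof.
move=> s t st; rewrite /rc_mod_ext; apply: rc_mod_nd.
  by rewrite le_max lexx.
by rewrite ge_max !le_max lexx/= st orbT.
Qed.

Lemma rc_mod_ext_right_continuous : right_continuous (rc_mod_ext T q).
Proof.
move=> t; apply/cvgrPdist_le => e e0.
suff [s ts hs] : exists2 s, t < s & rc_mod_ext T q s <= rc_mod_ext T q t + e.
  near=> r.
  have tr : t <= r by near: r; exact: nbhs_right_ge.
  have rs : r <= s by near: r; exact: nbhs_right_le.
  rewrite distrC ger0_norm ?subr_ge0; last exact: rc_mod_ext_nondecreasing.
  by rewrite lerBlDl (le_trans _ hs)// rc_mod_ext_nondecreasing.
have [Tt|tT] := leP T t.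
  exists (t + 1); first by rewrite ltrDl.
  have t1 : T <= t + 1 by rewrite (le_trans Tt)// lerDl.
  by rewrite /rc_mod_ext !rc_mod_geT ?le_max ?Tt ?t1 ?orbT// lerDl ltW.
set m := Num.max 0 t.
have m0 : 0 <= m by rewrite le_max lexx.
have mT : m < T by rewrite gt_max T_gt0.
have [_ [s /= + <-] hs] : exists2 y, (q @` `]m, T]) y &
    y < inf (q @` `]m, T]) + e.
  apply: inf_adherent => //; split; last exact: has_lbound_image.
  by exists (q T); exact: nonempty_image.
rewrite in_itv/= => /andP[ms sT].
exists ((m + s) / 2).
  by rewrite (le_lt_trans _ (midf_lt ms).1)// le_max lexx orbT.
have h : 0 <= (m + s) / 2 by rewrite (le_trans m0)// (midf_le (ltW ms)).1.
rewrite {2}/rc_mod_ext -/m (rc_mod_inf m0 mT) (le_trans _ (ltW hs))//.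
rewrite /rc_mod_ext (max_idPr h); apply: rc_mod_le => //.
by rewrite sT (midf_lt ms).2.
Unshelve. all: by end_near. Qed.

Definition rc_mod_cumulative : cumulative R R :=
  HB.pack_for (cumulative R R) (rc_mod_ext T q)
    (isCumulative.Build R _ R (rc_mod_ext T q)
      rc_mod_ext_nondecreasing rc_mod_ext_right_continuous).

Definition rc_mod_measure : {measure set (measurableTypeR R) -> \bar R} :=
  lebesgue_stieltjes_measure rc_mod_cumulative.

Lemma rc_mod_measure_itv a b : 0 <= a -> a < b -> b <= T ->
  rc_mod_measure `]a, b]%classic = (rc_mod T q b - rc_mod T q a)%:E.
Proof.
move=> a0 ab bT; rewrite /rc_mod_measure /lebesgue_stieltjes_measure /=.
rewrite [LHS]measurable_mu_extE/=; last exact: is_ocitv.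
rewrite wlength_itv_bnd ?ltW//= /rc_mod_ext.
by rewrite (max_idPr a0) (max_idPr (le_trans a0 (ltW ab))).
Qed.

End Cumulative.
End RightContinuousModification.

(* Right continuity of q at 0 has to be required separately: if q is the limit of
   the square sums, then for f y = y ^+ 2 the second-order sums converge to
   2 * q T whereas the integral is 2 * (q T - q 0+), since the measure lives on
   ]0, T].  The mass q 0+ may be positive: take T = 1, x 0 = 0 and x a triangular
   bump of height k^-1/2 vanishing at the endpoints of [1/(k+1), 1/k] for each
   k >= 1, and partitions made of ]0, 1/N] with N ~ 3n, of the half-bumps
   for n <= k < N and of a fine subdivision of ]1/n, 1].  Then x is continuous,
   the mesh oscillation tends to 0, and the square sums tend to 2 * ln 3 at every
   t > 0.                                                                     *)

(* Main.v *)
Require Import Defs.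
From mathcomp Require Import all_boot all_order all_algebra.
From mathcomp Require Import all_classical all_reals all_analysis.
From mathcomp Require Import measurable_realfun ring lra.

Set Implicit Arguments.
Unset Strict Implicit.
Unset Printing Implicit Defensive.

Import Order.TTheory GRing.Theory Num.Theory.
Import numFieldNormedType.Exports.

Local Open Scope classical_set_scope.
Local Open Scope ring_scope.

(** Everything rests on how the pieces ]u, v] sit around the jump times of [x].
    The piece of a jump time is eventually separated from any later time
    ([jump_piece_separated]).  Indeed, [A2] says that [x] at the left endpoint
    of the piece of [s] tends to the left limit at [s]; if one piece contained a
    jump time [r] and all of ]r, s] for infinitely many [n], the left limits at
    all these points would agree, and [r] would not be a jump time.  Hence the
    right endpoint of the piece of [r] tends to [r], and the increment over this
    piece tends to the jump at [r].  The mesh need not tend to 0: a piece may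
    cover an interval on which [x] is constant.

    Second-order sums ([weighted_square_sum_cvg]).  For a continuous [g], the sum
    of g (x u) (x v - x u)^2 is followed along a finite chain of points
    0 = s_0 < ... < s_m = T with [x] almost constant on each [s_j, s_(j+1)[.
    The chain is never built: [cadlag_induction] is an induction principle along
    it.  Its points are 0, T, jump times of [x] and continuity points of [q],
    where the square sums converge and [q] agrees with its
    right-continuous modification.  Between two of them, the sum and the
    integral are both close to g (x s_j) (q s_(j+1) - q s_j).  The delicate point
    is a piece with some s_j in its interior: since x u tends to the left limit at
    s_j, it is charged to the part before s_j when s_j is a jump time, and to the
    part after it otherwise ([precedes]); in both cases the mass charged up to
    s_j has the same limit as the square sum stopped at s_j
    ([weighted_sum1_cvg]).

    Taylor remainders ([taylor_remainder_sum_cvg]).  Summing Taylor's formula of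
    order 2 over the pieces, f (x T) - f (x 0) is the first-order sum, plus half
    the second-order sum, plus the sum of the remainders.  The jumps of size
    at least some [c] lie in finitely many distinct pieces, whose remainders tend to those
    of the jumps.  [A1] makes [x] oscillate little over the other
    pieces, where the remainder is therefore a small multiple of the squared
    increment; the total of the squared increments is bounded because it
    converges to [q T].  The same bound gives the convergence of the sum of the
    squared jumps, hence that of the jump term.

    The second-order sums and the remainders converge, so the first-order sums
    converge too, and their limit is read off Taylor's formula. *)

(** * Pieces of a partition *)

Section Chains.
Context {R : realType}.
Implicit Types (a t : R) (s : seq R) (I J : R * R).

Lemma mem_chain a s I : path <%R a s -> I \in zip (a :: s) s ->
  [/\ a <= I.1, I.1 < I.2 & I.2 <= last a s].
Proof.
elim: s a => [|b s IH] a //= /andP[ab bs]; rewrite inE => /orP[/eqP ->/=|Is].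
  split=> //; have := @itv_partition_le _ R b (last b s) s; apply.
  by split.
by have [bI I12 Il] := IH b bs Is; split=> //; rewrite (le_trans (ltW ab)).
Qed.

Lemma chain_separated a s I J : path <%R a s ->
  I \in zip (a :: s) s -> J \in zip (a :: s) s ->
  [\/ I = J, I.2 <= J.1 | J.2 <= I.1].
Proof.
elim: s a => [|b s IH] a //= /andP[ab bs].
rewrite !inE => /orP[/eqP ->|Is] /orP[/eqP ->|Js].
- exact: Or31.
- by apply: Or32 => /=; have [] := mem_chain bs Js.
- by apply: Or33 => /=; have [] := mem_chain bs Is.
- exact: IH bs Is Js.
Qed.

Lemma chain_uniq a s : path <%R a s -> uniq (zip (a :: s) s).
Proof.
move=> as_; apply: (@map_uniq _ _ snd); rewrite -/(unzip2 _) unzip2_zip//.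
by have /= /andP[] := lt_sorted_uniq (as_ : sorted <%R (a :: s)).
Qed.

Lemma chain_cover a s t : a < t <= last a s ->
  exists2 I, I \in zip (a :: s) s & I.1 < t <= I.2.
Proof.
elim: s a => [|b s IH] a /=.
  by move=> /andP[/lt_le_trans /[apply]]; rewrite ltxx.
move=> /andP[at_ tl]; have [tb|bt] := leP t b.
  by exists (a, b); rewrite ?inE ?eqxx//= at_.
have [|I Is It] := IH b; first by rewrite bt.
by exists I => //; rewrite inE Is orbT.
Qed.

Lemma chain_telescope a s (F : R -> R) :
  \sum_(I <- zip (a :: s) s) (F I.2 - F I.1) = F (last a s) - F a.
Proof.
elim: s a => [|b s IH] a /=; first by rewrite big_nil subrr.
by rewrite big_cons IH/=; ring.
Qed.

End Chains.

Section Pieces.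
Context {R : realType}.
Variables (T : R) (s : seq R).
Hypothesis s_part : itv_partition 0 T s.
Implicit Types (t : R) (I J : R * R).

Definition piece_at (s : seq R) t : R * R :=
  head (0, 0) [seq I <- pieces s | I.1 < t <= I.2].

Lemma mem_pieces I : I \in pieces s -> [/\ 0 <= I.1, I.1 < I.2 & I.2 <= T].
Proof. by case: s_part => sp /eqP <-; exact: mem_chain. Qed.

Lemma pieces_separated I J : I \in pieces s -> J \in pieces s ->
  [\/ I = J, I.2 <= J.1 | J.2 <= I.1].
Proof. by case: s_part => sp _; exact: chain_separated. Qed.

Lemma pieces_uniq : uniq (pieces s).
Proof. by case: s_part => sp _; exact: chain_uniq. Qed.

Lemma pieces_telescope (F : R -> R) :
  \sum_(I <- pieces s) (F I.2 - F I.1) = F T - F 0.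
Proof. by case: s_part => _ /eqP <-; exact: chain_telescope. Qed.

Lemma piece_at_mem t : 0 < t <= T ->
  piece_at s t \in pieces s /\ (piece_at s t).1 < t <= (piece_at s t).2.
Proof.
case: s_part => _ /eqP sT; rewrite -sT => /chain_cover[I Is It]; rewrite /piece_at.
set P := fun I : R * R => I.1 < t <= I.2.
have : I \in seq.filter P (pieces s) by rewrite mem_filter /P It.
have := mem_filter P ^~ (pieces s).
case: (seq.filter _ _) => // J l /(_ J); rewrite inE eqxx /= => /esym/andP[PJ Js] _.
by split.
Qed.

Lemma piece_at_eq t I : I \in pieces s -> I.1 < t <= I.2 -> piece_at s t = I.
Proof.
move=> Is /andP[It tI].
have [I0 _ IT] := mem_pieces Is.
have [|Js /andP[Jt tJ]] := @piece_at_mem t.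
  by rewrite (le_lt_trans I0 It) (le_trans tI).
case: (pieces_separated Js Is) => // h.
- by have := lt_le_trans (le_lt_trans h It) tJ; rewrite ltxx.
- by have := lt_le_trans (le_lt_trans h Jt) tI; rewrite ltxx.
Qed.

End Pieces.

(** * Induction along a càdlàg path *)

Section Cadlag.
Context {R : realType}.
Variables (T : R) (x : R -> R).
Hypothesis x_cadlag : cadlag T x.
Implicit Types (s t e c : R).

Lemma cadlag_right t e : 0 <= t < T -> 0 < e ->
  exists2 b, t < b <= T & forall s, t <= s < b -> `|x s - x t| < e.
Proof.
move=> tT e0; have [/(_ t tT) xt _] := x_cadlag.
have [d /= d0 xd] := cvgr_distC_lt _ _ xt _ e0.
have /andP[t0 ltT] := tT.
exists (Num.min T (t + d)).
  by rewrite lt_min ltT ltrDl d0 ge_min lexx.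
move=> s /andP[]; rewrite le_eqVlt => /predU1P[<- _|ts].
  by rewrite subrr normr0.
rewrite lt_min => /andP[sT sd]; apply: xd => //=.
by rewrite ltr_norml; apply/andP; split; lra.
Qed.

Lemma cadlag_left t e : 0 < t <= T -> 0 < e ->
  exists2 a, 0 <= a < t & forall s, a < s < t -> `|x s - left_lim x t| < e.
Proof.
move=> tT e0; have [_ /(_ t tT) xt] := x_cadlag.
have [d /= d0 xd] := cvgr_distC_lt _ _ xt _ e0.
have /andP[t0 leT] := tT.
exists (Num.max 0 (t - d)).
  by rewrite gt_max le_max lexx t0 ltrBlDr ltrDl.
move=> s; rewrite gt_max => /andP[/andP[s0 sd] st]; apply: xd => //=.
by rewrite ltr_norml; apply/andP; split; lra.
Qed.

Lemma left_lim_le t a e c : 0 < t <= T -> a < t ->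
  (forall s, a < s < t -> `|x s - c| <= e) -> `|left_lim x t - c| <= e.
Proof.
move=> tT at_ xe; have [_ /(_ t tT) xt] := x_cadlag.
have : `|x s - c| @[s --> t^'-] --> `|left_lim x t - c|.
  by apply: cvg_norm; apply: cvgB => //; exact: cvg_cst.
move/cvgr_to_le; apply; near=> s; apply: xe; apply/andP; split.
  by near: s; exact: nbhs_left_gt.
by near: s; exact: nbhs_left_lt.
Unshelve. all: by end_near. Qed.

(** This is induction along a chain 0 = s_0 < ... < s_m = T such that [x]
    oscillates by at most [e] on each [s_j, s_(j+1)[.  The points of the
    chain are taken in [good], which only has to be dense as long as it contains
    the jump times: around any other point [x] is continuous, so the chain can
    step over it.  The proof looks at the supremum of the good points where [P]
    holds, and extends the chain beyond it unless it is [T]. *)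
Lemma cadlag_induction (good P : R -> Prop) e : 0 < T -> 0 < e ->
  good 0 -> good T ->
  (forall t, 0 < t <= T -> jump x t != 0 -> good t) ->
  (forall a b, 0 <= a -> a < b -> b <= T -> exists2 c, a < c < b & good c) ->
  P 0 ->
  (forall s t, 0 <= s -> s < t -> t <= T -> good s -> good t ->
    (forall r, s <= r < t -> `|x r - x s| <= e) -> P s -> P t) ->
  P T.
Proof.
move=> T0 e0 good0 goodT goodJ goodD P0 PS.
pose A : set R := [set t | [/\ 0 <= t <= T, good t & P t]].
have A0 : A 0 by split; rewrite ?lexx ?ltW.
have supA : has_sup A by split; [exists 0|exists T => t [/andP[]]].
pose c := sup A.
have Ac t : A t -> t <= c by move=> At; exact: (ub_le_sup supA.2 At).
have c0 : 0 <= c by exact: Ac.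
have cT : c <= T by apply: ge_sup; [exists 0|move=> t [/andP[]]].
have e20 : 0 < e / 2 by rewrite divr_gt0.
(* Left limits at [c] give a point of [A] from which [c] is one step away. *)
have approach : exists t, [/\ A t, t <= c & forall r, t <= r < c ->
    `|x r - x t| <= e /\ `|x r - left_lim x c| < e / 2].
  have [c00|cn0] := eqVneq c 0.
    by exists 0; split => // r /andP[r0]; rewrite c00 ltNge r0.
  have cgt0 : 0 < c by rewrite lt_neqAle eq_sym cn0.
  have [||a /andP[a0 ac] xa] := @cadlag_left c (e / 2); rewrite ?cgt0 ?e20//.
  have [|t At] := @sup_adherent _ A (c - a) _ supA; first by rewrite subr_gt0.
  rewrite -/c opprB addrC subrK => at_.
  exists t; split => //; first exact: Ac.
  move=> r /andP[tr rc]; have h1 := xa r; have h2 := xa t.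
  rewrite (lt_le_trans at_ tr) rc in h1.
  rewrite at_ (le_lt_trans tr rc) in h2.
  have := h1 isT; have := h2 isT; rewrite !ltr_norml ler_norml.
  by move=> /andP[? ?] /andP[? ?]; split; apply/andP; split; lra.
have [t [At tc xt]] := approach.
have [t0T goodt Pt] := At; have t0 : 0 <= t by case/andP: t0T.
have [goodc|bad] := pselect (good c).
  have {At tc xt approach Pt goodt t0 t0T t} [_ _ Pc] : A c.
    move: tc; rewrite le_eqVlt => /predU1P[<- //|tc].
    split => //; first by rewrite c0.
    by apply: (PS t) => // r /xt[].
  have [<- //|cnT] := eqVneq c T.
  have {}cT : c < T by rewrite lt_neqAle cnT.
  have [||b /andP[cb bT] xb] := @cadlag_right c e; rewrite ?c0//.
  have [d /andP[cd db] goodd] := goodD c b c0 cb bT.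
  have dT : d <= T by rewrite (le_trans (ltW db)).
  suff /Ac : A d by rewrite leNgt cd.
  split => //; first by rewrite dT (le_trans c0 (ltW cd)).
  apply: (PS c) => // r /andP[cr rd]; rewrite ltW// xb// cr.
  exact: lt_trans db.
(* [x] is continuous at [c], so one step leads from [t] past [c]. *)
have {}tc : t < c.
  by move: tc; rewrite le_eqVlt => /predU1P[tc|//]; rewrite -tc in bad.
have cgt0 : 0 < c by exact: le_lt_trans tc.
have {}cT : c < T.
  by move: cT; rewrite le_eqVlt => /predU1P[cT|//]; rewrite cT in bad.
have jc : left_lim x c = x c.
  apply/esym/eqP; rewrite -subr_eq0; apply: contrapT => /negP jc.
  by apply/bad/goodJ => //; rewrite cgt0 ltW.
have [||b /andP[cb bT] xb] := @cadlag_right c (e / 2); rewrite ?c0 ?e20//.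
have [d /andP[cd db] goodd] := goodD c b c0 cb bT.
have dT : d <= T by rewrite (le_trans (ltW db)).
suff /Ac : A d by rewrite leNgt cd.
split => //; first by rewrite dT (le_trans c0 (ltW cd)).
apply: (PS t) => //; first exact: lt_trans cd.
move=> r /andP[tr rd]; have [rc|cr] := ltP r c.
  by case: (xt r); rewrite ?tr.
have [|_] := xt t; first by rewrite lexx tc.
rewrite jc.
have := xb r; rewrite cr (lt_trans rd db) => /(_ isT).
by rewrite !ltr_norml ler_norml => /andP[? ?] /andP[? ?]; apply/andP; split; lra.
Qed.

Lemma cadlag_bounded : 0 < T -> exists M, forall t, 0 <= t <= T ->
  `|x t| <= M /\ (0 < t -> `|left_lim x t| <= M).
Proof.
move=> T_gt0.
suff [M xM] : exists M, forall t, 0 <= t <= T -> `|x t| <= M.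
  exists M => t /andP[t0 tT]; split; first by apply: xM; rewrite t0.
  move=> tgt0; rewrite -[left_lim x t]subr0.
  apply: (left_lim_le (a := 0)) => //; first by rewrite tgt0.
  by move=> s /andP[s0 st]; rewrite subr0 xM// !ltW//= (lt_le_trans st).
apply: (cadlag_induction (good := fun=> True) (e := 1)
  (P := fun t => exists M, forall s, 0 <= s <= t -> `|x s| <= M)) => //.
- move=> a b _ ab _; exists ((a + b) / 2) => //.
  by have [-> ->] := midf_lt ab.
- by exists `|x 0| => s /le_anti ->.
- move=> s t s0 st tT _ _ xst [M xM].
  exists (Num.max (Num.max M (`|x s| + 1)) `|x t|) => r /andP[r0 rt].
  rewrite !le_max; have [rs|sr] := leP r s; first by rewrite xM// r0.
  move: rt; rewrite le_eqVlt => /predU1P[->|rt]; first by rewrite lexx orbT.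
  have := xst r; rewrite rt (ltW sr) => /(_ isT) xr.
  suff -> : `|x r| <= `|x s| + 1 by rewrite orbT.
  by rewrite -(subrK (x s) (x r)) (le_trans (ler_normD _ _))// addrC lerD2l.
Qed.

End Cadlag.

(** * Continuity points of a monotone function *)

Section MonotoneContinuity.
Context {R : realType}.

(** A monotone function has countably many discontinuities, whereas an open
    interval has positive Lebesgue measure. *)
Lemma nondecreasing_dense_continuity (q : R -> R) (a b : R) : a < b ->
  {in `[a, b] &, {homo q : s t / s <= t}} ->
  exists2 c, a < c < b & q s @[s --> c] --> q c.
Proof.
move=> ab ndq.
have [c cab cD] : exists2 c, c \in `]a, b[ & ~ discontinuity q c.
  apply: contrapT => noc.
  have := countable_lebesgue_measure0 (discontinuity_countable ndq).
  rewrite [X in lebesgue_measure X](_ : _ = `]a, b[%classic).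
    rewrite lebesgue_measure_itv/= lte_fin ab -EFinD => -[] /eqP.
    by rewrite subr_eq0 gt_eqF.
  apply/seteqP; split=> c; [by case|move=> cab; split => //].
  by apply: contrapT => nd; apply: noc; exists c.
move: (cab); rewrite in_itv/= => /andP[ac cb].
have [ac' cb'] := (ltW ac, ltW cb).
have cvgl : cvg (q s @[s --> c^'-]).
  apply: nondecreasing_at_left_is_cvgr.
  - near=> y.
    have ay : a <= y by near: y; exact: nbhs_left_ge.
    move=> s t; rewrite !in_itv/= => /andP[ys sc] /andP[yt tc] st.
    by apply: ndq => //; rewrite in_itv/=; apply/andP; split; lra.
  - near=> y; exists (q c) => _ [s + <-]; rewrite /= in_itv/= => /andP[ys sc].
    have ay : a <= y by near: y; exact: nbhs_left_ge.
    by apply: ndq; rewrite ?in_itv/= ?(ltW sc)//; apply/andP; split; lra.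
have cvgr : cvg (q s @[s --> c^'+]).
  apply: nondecreasing_at_right_is_cvgr.
  - near=> y.
    have yb : y <= b by near: y; exact: nbhs_right_le.
    move=> s t; rewrite !in_itv/= => /andP[ys sc] /andP[yt tc] st.
    by apply: ndq => //; rewrite in_itv/=; apply/andP; split; lra.
  - near=> y; exists (q c) => _ [s + <-]; rewrite /= in_itv/= => /andP[ys sc].
    have yb : y <= b by near: y; exact: nbhs_right_le.
    by apply: ndq; rewrite ?in_itv/= ?(ltW ys)//; apply/andP; split; lra.
exists c; first by rewrite ac.
have lr : lim (q s @[s --> c^'-]) = lim (q s @[s --> c^'+]).
  by apply/eqP; apply: contrapT => /negP ne; apply: cD; split.
have lc : lim (q s @[s --> c^'-]) <= q c.
  apply: limr_le => //; near=> s.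
  have as_ : a <= s by near: s; exact: nbhs_left_ge.
  have sc : s <= c by near: s; exact: nbhs_left_le.
  by apply: ndq; rewrite ?in_itv/=//; apply/andP; split; lra.
have cr : q c <= lim (q s @[s --> c^'+]).
  apply: limr_ge => //; near=> s.
  have as_ : s <= b by near: s; exact: nbhs_right_le.
  have sc : c <= s by near: s; exact: nbhs_right_ge.
  by apply: ndq; rewrite ?in_itv/=//; apply/andP; split; lra.
have qc : q c = lim (q s @[s --> c^'-]) by apply/eqP; rewrite eq_le lc lr cr.
apply/left_right_continuousP; split; first by rewrite qc.
by rewrite qc lr.
Unshelve. all: by end_near. Qed.

End MonotoneContinuity.

(** * Pieces around jump times *)

Section JumpPieces.
Context {R : realType}.
Variables (T : R) (x : R -> R) (pi : nat -> seq R).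
Hypothesis x_cadlag : cadlag T x.
Hypothesis pi_partition : forall n, itv_partition 0 T (pi n).
Hypothesis pi_A2 : A2 T x pi.
Implicit Types (r s t e : R) (I : R * R).

Definition sqr_incr (x : R -> R) I : R := (x I.2 - x I.1) ^+ 2.

Lemma sqr_incr_ge0 I : 0 <= sqr_incr x I.
Proof. exact: sqr_ge0. Qed.

(** If the piece of [r] kept reaching some [s > r], its left endpoint would be
    shared by all the points of ]r, s], so that [x] would have the same left
    limit at all of them and at [r]; by right continuity, [r] is then no jump
    time.  A single point [r'] of ]r, s] close enough to [r] suffices. *)
Lemma jump_piece_separated r s : 0 < r -> jump x r != 0 -> r < s <= T ->
  \forall n \near \oo, (piece_at (pi n) r).2 < s.
Proof.
move=> r0 jr /andP[rs sT].
have rT : r < T by exact: lt_le_trans sT.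
pose e := `|jump x r| / 4.
have e0 : 0 < e by rewrite divr_gt0// normr_gt0.
have [||b /andP[rb bT] xb] := @cadlag_right _ _ _ x_cadlag r e; rewrite ?ltW//.
pose m := Num.min b s; have rm : r < m by rewrite lt_min rb.
pose r' := (r + m) / 2.
have [rr' r'm] : r < r' /\ r' < m by have [] := midf_lt rm.
have [r'b r's] : r' < b /\ r' < s by move: r'm; rewrite lt_min => /andP[].
have r'T : 0 < r' <= T.
  by rewrite (lt_trans r0 rr') (le_trans (ltW r'b) bT).
have xr' : `|left_lim x r' - x r| <= e.
  apply: (left_lim_le x_cadlag r'T rr') => z /andP[rz zr'].
  by rewrite ltW// xb// ltW//= (lt_trans zr').
have rT' : 0 < r <= T by rewrite r0 ltW.
near=> n; rewrite ltNge; apply/negP => sn.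
have [In /andP[I1r rI2]] := piece_at_mem (pi_partition n) rT'.
have same : piece_at (pi n) r' = piece_at (pi n) r.
  apply: (piece_at_eq (pi_partition n)) => //.
  by rewrite (lt_trans I1r rr') (le_trans (ltW r's)).
have h1 : `|left_lim x r - x (left_endpoint (pi n) r)| < e.
  by near: n; apply: cvgr_dist_lt => //; exact: pi_A2.
have h2 : `|left_lim x r' - x (left_endpoint (pi n) r')| < e.
  by near: n; apply: cvgr_dist_lt => //; exact: pi_A2.
have e4 : `|x r - left_lim x r| = e * 4 by rewrite /e divfK// pnatr_eq0.
move: h1 h2; rewrite /left_endpoint -!/(piece_at _ _) same => h1 h2.
move: h1 h2 xr' e4; set y := x _; rewrite !ltr_norml !ler_norml.
move=> /andP[? ?] /andP[? ?] /andP[? ?].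
by have [?|?] := ger0P (x r - left_lim x r) => ?; lra.
Unshelve. all: by end_near. Qed.

Lemma jump_right_endpoint_cvg r : 0 < r <= T -> jump x r != 0 ->
  x (piece_at (pi n) r).2 @[n --> \oo] --> x r.
Proof.
move=> /andP[r0 rT] jr; have rT' : 0 < r <= T by rewrite r0.
apply/cvgrPdist_lt => e e0; have [rT1|Tr] := ltP r T; last first.
  near=> n; have [/(mem_pieces (pi_partition n))[_ _ h] /andP[_ h']] :=
    piece_at_mem (pi_partition n) rT'.
  suff -> : (piece_at (pi n) r).2 = r by rewrite subrr normr0.
  by apply/eqP; rewrite eq_le h' (le_trans h).
have [||b rb xb] := @cadlag_right _ _ _ x_cadlag r e; rewrite ?ltW//.
near=> n; rewrite distrC xb//.
have [_ /andP[_ ->]] := piece_at_mem (pi_partition n) rT'.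
by near: n; exact: jump_piece_separated.
Unshelve. all: by end_near. Qed.

Lemma jump_sqr_incr_cvg r : 0 < r <= T -> jump x r != 0 ->
  sqr_incr x (piece_at (pi n) r) @[n --> \oo] --> jump x r ^+ 2.
Proof.
move=> rT jr; rewrite /sqr_incr.
have h : x (piece_at (pi n) r).2 - x (piece_at (pi n) r).1
    @[n --> \oo] --> jump x r.
  by apply: cvgB; [exact: jump_right_endpoint_cvg|exact: pi_A2].
rewrite expr2; under eq_cvg do rewrite expr2.
exact: cvgM.
Qed.

(** The pieces charged to the interval ]0, t].  One that has [t] in its
    interior is charged to it when [t] is a jump time, because its increment is then almost the jump at [t]; otherwise its
    increment up to [t] is negligible, and whatever comes later (for instance a
    jump at its right endpoint) is left to the points beyond [t]. *)
Definition precedes (x : R -> R) t I : bool :=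
  if jump x t != 0 then I.1 < t else I.2 <= t.

Definition weighted_sum (x : R -> R) (g : R -> R) (p : seq R) t : R :=
  \sum_(I <- pieces p | precedes x t I) g (x I.1) * sqr_incr x I.

(** Only the piece of [t] is counted differently by the square sum stopped at
    [t] and by the sum of the squared increments charged to ]0, t]. *)
Lemma square_sum_split n t : 0 < t <= T ->
  let I0 := piece_at (pi n) t in
  square_sum x (pi n) t - weighted_sum x (fun=> 1) (pi n) t =
  (x t - x I0.1) ^+ 2 - (if precedes x t I0 then sqr_incr x I0 else 0).
Proof.
move=> tT I0; have [I0n /andP[I01 I02]] := piece_at_mem (pi_partition n) tT.
rewrite /square_sum /weighted_sum [X in _ - X]big_mkcond/=.
rewrite (bigD1_seq I0)//=; last exact: pieces_uniq (pi_partition n).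
rewrite [X in _ - X](bigD1_seq I0)//=; last exact: pieces_uniq (pi_partition n).
rewrite (min_idPr I02) (min_idPl (ltW I01)) mul1r opprD addrACA.
set A := \sum_(_ <- _ | _) _; set B := \sum_(_ <- _ | _) _.
suff -> : A = B by rewrite subrr addr0.
rewrite /A /B big_seq_cond [RHS]big_seq_cond; apply: eq_bigr => J /andP[Jn JI0].
have [J1 J12 J2] := mem_pieces (pi_partition n) Jn.
rewrite mul1r /precedes /sqr_incr.
case: (pieces_separated (pi_partition n) Jn I0n) => [JI|JI|JI].
- by rewrite JI eqxx in JI0.
- have J2t : J.2 < t by exact: le_lt_trans I01.
  have J1t := lt_trans J12 J2t.
  by rewrite (min_idPl (ltW J2t)) (min_idPl (ltW J1t)) J1t (ltW J2t) if_same.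
- have tJ1 : t <= J.1 by exact: le_trans JI.
  have tJ2 := le_lt_trans tJ1 J12.
  rewrite (min_idPr tJ1) (min_idPr (ltW tJ2)) subrr expr0n/=.
  by rewrite ltNge tJ1/= leNgt tJ2/= if_same.
Qed.

(** If [t] is a jump time, both contributions of its piece tend to the squared
    jump; otherwise the stopped one tends to 0, and so does the difference. *)
Lemma weighted_sum1_cvg t (l : R) : 0 < t <= T ->
  square_sum x (pi n) t @[n --> \oo] --> l ->
  weighted_sum x (fun=> 1) (pi n) t @[n --> \oo] --> l.
Proof.
move=> tT sl.
suff h : square_sum x (pi n) t - weighted_sum x (fun=> 1) (pi n) t
    @[n --> \oo] --> (0 : R).
  rewrite -[l]subr0.
  under eq_cvg => n do rewrite -(subKr (square_sum x (pi n) t)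
    (weighted_sum x (fun=> 1) (pi n) t)).
  exact: cvgB.
rewrite (funext (fun n => square_sum_split n tT)).
have d : (x t - x (piece_at (pi n) t).1) ^+ 2 @[n --> \oo] --> jump x t ^+ 2.
  have : x t - x (piece_at (pi n) t).1 @[n --> \oo] --> jump x t.
    by apply: cvgB; [exact: cvg_cst|exact: pi_A2].
  by move=> h; rewrite expr2; under eq_cvg do rewrite expr2; exact: cvgM.
have [jt|jt] := boolP (jump x t != 0).
  have E n : precedes x t (piece_at (pi n) t).
    have [_ /andP[I1 _]] := piece_at_mem (pi_partition n) tT.
    by rewrite /precedes jt.
  under eq_cvg do rewrite E.
  by have h := cvgB d (jump_sqr_incr_cvg tT jt); rewrite subrr in h; exact: h.
have {}d : (x t - x (piece_at (pi n) t).1) ^+ 2 @[n --> \oo] --> (0 : R).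
  by move: d; rewrite (eqP (negPn jt)) expr0n.
apply: (squeeze_cvgr _ (cvg_cst 0) d); near=> n.
have [_ /andP[_ I2]] := piece_at_mem (pi_partition n) tT.
rewrite /precedes (negbTE jt)/=; case: ifPn => [I2'|_].
  have I2t : (piece_at (pi n) t).2 = t by apply/eqP; rewrite eq_le I2 I2'.
  by rewrite /sqr_incr I2t subrr lexx sqr_ge0.
by rewrite subr0 sqr_ge0 lexx.
Unshelve. all: by end_near. Qed.

Lemma weighted_sum_at0 g n : weighted_sum x g (pi n) 0 = 0.
Proof.
rewrite /weighted_sum big_seq_cond big_pred0// => I; apply/negP => /andP[In].
have [I1 I12 _] := mem_pieces (pi_partition n) In.
by rewrite /precedes; case: ifP => _; lra.
Qed.

Lemma weighted_sum_atT g n : weighted_sum x g (pi n) T =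
  \sum_(I <- pieces (pi n)) g (x I.1) * sqr_incr x I.
Proof.
rewrite /weighted_sum big_mkcond big_seq [RHS]big_seq; apply: eq_bigr => I In.
have [I1 I12 I2] := mem_pieces (pi_partition n) In.
by rewrite /precedes I2 (lt_le_trans I12 I2) if_same.
Qed.

(** This can fail for small [n]: a piece charged to ]0, s] because [s] is a jump
    time may reach beyond [t] until it is separated from [t]. *)
Lemma precedes_mono s t : 0 <= s -> s < t <= T ->
  \forall n \near \oo, {in pieces (pi n), forall I,
    precedes x s I -> precedes x t I}.
Proof.
move=> s0 /andP[st tT].
have goal I : I.1 < I.2 -> I.2 <= s -> precedes x t I.
  by move=> I12 I2s; rewrite /precedes; case: ifP => _; lra.
have [js|js] := boolP (jump x s != 0); last first.
  near=> n => I In; have [_ I12 _] := mem_pieces (pi_partition n) In.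
  by rewrite {1}/precedes (negbTE js); exact: goal.
have [sgt0|] := ltP 0 s; last first.
  move=> s0'; near=> n => I In; have [I1 I12 _] := mem_pieces (pi_partition n) In.
  by rewrite {1}/precedes js => I1s; exfalso; lra.
near=> n => I In; have [I1 I12 _] := mem_pieces (pi_partition n) In.
rewrite {1}/precedes js => I1s; have [sI|Is] := leP s I.2; last first.
  by apply: goal => //; exact: ltW.
have I2t : I.2 < t.
  rewrite -(piece_at_eq (pi_partition n) In (t := s)) ?I1s//.
  by near: n; apply: jump_piece_separated; rewrite ?st.
by rewrite /precedes; case: ifP => _; lra.
Unshelve. all: by end_near. Qed.

(** A piece charged to ]s, t] starts in [s, t[, or else contains in its interior
    the point [s], at which [x] is then continuous; in the latter case [A2]
    brings [x] at its left endpoint close to [x s]. *)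
Lemma precedes_window s t e : 0 <= s -> s < t <= T -> 0 < e ->
  (forall r, s <= r < t -> `|x r - x s| <= e) ->
  \forall n \near \oo, {in pieces (pi n), forall I,
    precedes x t I -> ~~ precedes x s I -> `|x I.1 - x s| <= e}.
Proof.
move=> s0 /andP[st tT] e0 xe.
have below I : I.1 < I.2 -> precedes x t I -> I.1 < t.
  by move=> I12; rewrite /precedes; case: ifP => _; lra.
have [js|/negPn/eqP js] := boolP (jump x s != 0).
  near=> n => I In; have [_ I12 _] := mem_pieces (pi_partition n) In.
  move=> /(below _ I12) I1t; rewrite /precedes js -leNgt => sI1.
  by rewrite xe ?sI1.
have [sgt0|s0'] := ltP 0 s; last first.
  near=> n => I In; have [I1 I12 _] := mem_pieces (pi_partition n) In.
  by move=> /(below _ I12) I1t _; rewrite xe// I1t andbT; lra.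
have sT : 0 < s <= T by rewrite sgt0 ltW// (lt_le_trans st).
near=> n => I In; have [I1 I12 _] := mem_pieces (pi_partition n) In.
move=> /(below _ I12) I1t; rewrite /precedes js eqxx/= -ltNge => sI2.
have [sI1|I1s] := leP s I.1; first by rewrite xe ?sI1.
rewrite -(piece_at_eq (pi_partition n) In (t := s)) ?I1s ?ltW//.
have -> : x s = left_lim x s by apply/eqP; rewrite -subr_eq0 -/(jump x s) js.
by near: n; apply: cvgr_distC_lt => //; exact: pi_A2.
Unshelve. all: by end_near. Qed.

End JumpPieces.

(** * Uniform continuity and Taylor's formula *)

Section RealFunctions.
Context {R : realType}.
Implicit Types (f g : R -> R) (a b c e M : R).

(** Only [a] has to be in the segment, which spares a case distinction in the
    applications.  Near coverings turn the pointwise moduli into a uniform one. *)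
Lemma continuous_segment_uniform g M e : continuous g -> 0 < e ->
  exists2 d, 0 < d & forall a b, `|a| <= M -> `|a - b| <= d -> `|g a - g b| <= e.
Proof.
move=> cg e0.
have cpt : compact `[- M, M]%classic by exact: segment_compact.
have [//|d /= d0 dP] := (compact_near_coveringP _).1 cpt R (0 : R)^'+
  (fun d a => forall b, `|a - b| <= d -> `|g a - g b| <= e).
  move=> a _.
  have e20 : 0 < e / 2 by rewrite divr_gt0.
  have /cvgrPdist_lt/(_ _ e20)[r /= r0 ar] := cg a.
  exists (ball a (r / 2), [set d | 0 < d < r / 2]) => /=.
    split; first by apply: nbhsx_ballx; rewrite divr_gt0.
    exists (r / 2); first by rewrite /= divr_gt0.
    by move=> d /=; rewrite distrC subr0 => dr d0; rewrite d0 -(gtr0_norm d0).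
  move=> [y d] /= [ay /andP[d0 dr]] b yb.
  have h1 : `|g a - g y| < e / 2.
    by apply: ar => /=; apply: (lt_trans ay); rewrite ltr_pdivrMr// ltr_pMr// ltr1n.
  have h2 : `|g a - g b| < e / 2.
    apply: ar => /=; rewrite -(subrK y a) -addrA (le_lt_trans (ler_normD _ _))//.
    by rewrite [ltRHS]splitr; apply: ltr_leD => //; exact/ltW/(le_lt_trans yb).
  rewrite -(subrK (g a) (g y)) -addrA (le_trans (ler_normD _ _))//.
  by rewrite [e]splitr lerD// ltW// distrC.
exists (d / 2); first by rewrite divr_gt0.
move=> a b aM ab; apply: (dP (d / 2)) => //=.
- by rewrite distrC subr0 gtr0_norm ?divr_gt0// ltr_pdivrMr// ltr_pMr// ltr1n.
- by rewrite divr_gt0.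
- by rewrite /= in_itv/= -ler_norml.
Qed.

Lemma continuous_segment_bounded g M : continuous g ->
  exists2 K, 0 < K & forall a, `|a| <= M -> `|g a| <= K.
Proof.
move=> cg.
have cpt : compact `[- M, M]%classic by exact: segment_compact.
have [K [_ gK]] := compact_bounded (continuous_compact
  (continuous_subspaceT cg : {within `[- M, M], continuous g}) cpt).
exists (`|K| + 1); first by rewrite ltr_wpDl.
move=> a aM; apply: gK; first by rewrite (le_lt_trans (ler_norm _))// ltrDl.
by exists a => //=; rewrite in_itv/= -ler_norml.
Qed.

Lemma MVT_between f a b : (forall y, derivable f y 1) ->
  exists2 c, Num.min a b <= c <= Num.max a b &
    f b - f a = derive1 f c * (b - a).
Proof.
move=> df.
have h u v : u <= v ->
    exists2 c, c \in `[u, v] & f v - f u = derive1 f c * (v - u).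
  move=> uv; apply: MVT_segment => // [y _|].
    by rewrite derive1E; exact: derivableP.
  apply: continuous_subspaceT => y; apply: differentiable_continuous.
  exact/derivable1_diffP.
have [ab|/ltW ba] := leP a b.
  by have [c] := h _ _ ab; rewrite in_itv/=; exists c.
have [c] := h _ _ ba; rewrite in_itv/= => cab fc; exists c => //.
by rewrite -opprB fc -mulrN opprB.
Qed.

Definition taylor_remainder f a b : R :=
  f b - f a - derive1 f a * (b - a) - 2^-1 * derive1n 2 f a * (b - a) ^+ 2.

(** The mean value theorem is applied to the remainder as a function of [b],
    whose derivative is, by the mean value theorem for [derive1 f], at most
    [e * `|b - a|]. *)
Lemma taylor_remainder_le f a b e : C2 f ->
  (forall c, Num.min a b <= c <= Num.max a b ->
    `|derive1n 2 f c - derive1n 2 f a| <= e) ->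
  `|taylor_remainder f a b| <= e * (b - a) ^+ 2.
Proof.
move=> [df d2f _] hf; set f2 : R := derive1n 2 f a in hf *.
pose r y := f y - f a - derive1 f a * (y - a) - 2^-1 * f2 * (y - a) ^+ 2.
have dr (y : R) : is_derive y 1 r (derive1 f y - derive1 f a - f2 * (y - a)).
  have := derivableP (df y); rewrite -derive1E => ?.
  rewrite /r; apply: is_derive_eq.
  rewrite !(mulr0, scaler0, addr0, subr0, add0r, mulr1, scale0r, scaler1)/=.
  by rewrite /GRing.scale/=; lra.
have [c cab rb] := MVT_between a b (fun y => @ex_derive _ _ _ _ _ _ _ (dr y)).
have ra : r a = 0 by rewrite /r !subrr expr0n/= !mulr0 !subr0.
have ca : `|c - a| <= `|b - a|.
  move: cab; rewrite minEle maxEle; case: ifPn => ab /andP[? ?].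
    by rewrite !ger0_norm ?subr_ge0; lra.
  by rewrite !ler0_norm ?subr_le0; lra.
rewrite -[taylor_remainder _ _ _]/(r b) -(subr0 (r b)) -ra rb.
rewrite normrM derive1E derive_val expr2 -[X in _ <= _ * X]ger0_norm ?sqr_ge0//.
rewrite -expr2 normrX expr2 mulrA ler_wpM2r//.
have [c' c'ac f1c] := MVT_between a c d2f.
rewrite f1c -mulrBl normrM ler_pM//.
apply: hf; move: cab c'ac.
by rewrite !minEle !maxEle; do 2!case: ifPn => ?; move=> /andP[? ?] /andP[? ?];
  apply/andP; split; lra.
Qed.

End RealFunctions.

(** * Second-order sums *)

Section SecondOrder.
Context {R : realType}.
Variables (T : R) (x : R -> R) (pi : nat -> seq R) (q : R -> R).
Hypothesis T_gt0 : 0 < T.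
Hypothesis x_cadlag : cadlag T x.
Hypothesis pi_partition : forall n, itv_partition 0 T (pi n).
Hypothesis pi_A2 : A2 T x pi.
Hypothesis q_nd : {in `[0, T] &, {homo q : a b / a <= b}}.
Hypothesis q_lim : forall t, 0 <= t <= T ->
  [\/ continuous_on_at T q t, t = T | 0 < t /\ jump x t != 0] ->
  square_sum x (pi n) t @[n --> \oo] --> q t.
Hypothesis q_rc : forall t, 0 < t < T -> jump x t != 0 ->
  q s @[s --> t^'+] --> q t.
Hypothesis q_rc0 : q s @[s --> 0^'+] --> q 0.
Implicit Types (s t a b c d e : R) (g : R -> R).

Let mu := rc_mod_measure T_gt0 q_nd.

(** The points at which the square sums converge to [q] and where [q] agrees
    with its right-continuous modification. *)
Definition admissible t : Prop :=
  [\/ t = 0, t = T, 0 < t /\ jump x t != 0 | q s @[s --> t] --> q t].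

Lemma admissible_dense a b : 0 <= a -> a < b -> b <= T ->
  exists2 c, a < c < b & admissible c.
Proof.
move=> a0 ab bT; have [|c acb qc] := nondecreasing_dense_continuity ab (q := q).
  move=> s t; rewrite !in_itv/= => /andP[as_ sb] /andP[at_ tb].
  by apply: q_nd; rewrite in_itv/=; apply/andP; split; lra.
by exists c => //; exact: Or44.
Qed.

(** Right continuity of [q] at 0 makes 0 a continuity point on [0, T], where the
    square sums, which vanish, must converge to [q 0]. *)
Lemma square_sum_limit_at0 : q 0 = 0.
Proof.
have q0c : continuous_on_at T q 0.
  rewrite /continuous_on_at.
  apply: cvg_trans (cvg_at_right_within q_rc0); apply: cvg_app.
  by apply: within_subset => s; rewrite /= in_itv/= => /andP[].
have := q_lim (t := 0); rewrite lexx ltW// => /(_ isT (Or31 _ _ q0c)).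
have -> : (fun n => square_sum x (pi n) 0) = cst 0.
  apply/funext => n; rewrite /square_sum big_seq big1// => I In.
  have [I1 I12 _] := mem_pieces (pi_partition n) In.
  by rewrite !min_r ?subrr ?expr0n// (le_trans I1)// ltW.
by move=> h; have := cvg_unique _ h (cvg_cst 0); exact.
Qed.

Lemma admissible_cvg t : 0 <= t <= T -> admissible t ->
  weighted_sum x (fun=> 1) (pi n) t @[n --> \oo] --> q t.
Proof.
move=> /andP[t0 tT] adm; have [->|tn0] := eqVneq t 0.
  under eq_cvg do rewrite (weighted_sum_at0 _ pi_partition).
  by rewrite square_sum_limit_at0; exact: cvg_cst.
have tgt0 : 0 < t by rewrite lt_neqAle eq_sym tn0.
apply: (weighted_sum1_cvg x_cadlag pi_partition pi_A2); first by rewrite tgt0.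
apply: q_lim; first by rewrite t0.
case: adm => [t00|tT'|jt|qt].
- by rewrite t00 eqxx in tn0.
- exact: Or32.
- exact: Or33.
- by apply: Or31; exact: cvg_within_filter.
Qed.

Lemma admissible_rc_mod t : 0 <= t <= T -> admissible t -> rc_mod T q t = q t.
Proof.
move=> /andP[t0 tT] adm; rewrite /rc_mod; case: ltP => [ltT|Tt]; last first.
  by congr q; apply/eqP; rewrite eq_le Tt.
apply/cvg_lim => //; case: adm => [->//|tT'|[tgt0 jt]|qt].
- by rewrite tT' ltxx in ltT.
- by apply: q_rc => //; rewrite tgt0.
- exact: cvg_at_right_filter.
Qed.

Lemma admissible_measure s t : 0 <= s -> s < t -> t <= T ->
  admissible s -> admissible t -> mu `]s, t]%classic = (q t - q s)%:E.
Proof.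
move=> s0 st tT adms admt; rewrite /mu rc_mod_measure_itv//.
rewrite !admissible_rc_mod ?s0//.
- by rewrite (le_trans (ltW st)).
- by rewrite tT (le_trans s0 (ltW st)).
Qed.

(** By the convergence of [x] at the left endpoints, [left_lim x] is the
    pointwise limit of step functions. *)
Lemma left_lim_measurable : measurable_fun `]0, T] (left_lim x).
Proof.
apply: (measurable_fun_cvg (h := fun n t => x (left_endpoint (pi n) t))) => /=;
  last by move=> t; rewrite /= in_itv/=; exact: pi_A2.
move=> n; apply: (@eq_measurable_fun _ _ _ _ _ (fun t =>
  \sum_(I <- pieces (pi n)) x I.1 * \1_(`]I.1, I.2]%classic) t)); last first.
  by apply: measurable_sum => I; apply: measurable_funM.
move=> t; rewrite inE/= in_itv/= => tT.
have [I0n I0t] := piece_at_mem (pi_partition n) tT.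
rewrite (bigD1_seq (piece_at (pi n) t))//=; last exact: pieces_uniq (pi_partition n).
rewrite indicE mem_set/= ?in_itv//= mulr1 big_seq_cond big1 ?addr0//.
move=> J /andP[Jn JI0]; rewrite indicE memNset ?mulr0//= in_itv/=.
by move=> tJ; rewrite -(piece_at_eq (pi_partition n) Jn tJ) eqxx in JI0.
Qed.

Lemma left_lim_integrable g : continuous g ->
  mu.-integrable `]0, T] (fun t => (g (left_lim x t))%:E).
Proof.
move=> cg; have [M xM] := cadlag_bounded x_cadlag T_gt0.
have [K K0 gK] := continuous_segment_bounded M cg.
rewrite -[X in integrable _ _ X]/(EFin \o (fun t => g (left_lim x t))).
apply: measurable_bounded_integrable => //.
- by rewrite admissible_measure// ?ltry//; [exact: Or41|exact: Or42].
- apply: measurableT_comp left_lim_measurable.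
  exact: continuous_measurable_fun.
- exists K; split; first exact: num_real.
  move=> k Kk t; rewrite /= in_itv/= => /andP[t0 tT].
  rewrite (le_trans _ (ltW Kk))// gK//.
  by have [|_ ->//] := xM t; rewrite ltW.
Qed.

Lemma integral_increment g s t e : continuous g -> 0 <= s -> s < t -> t <= T ->
  admissible s -> admissible t ->
  (forall r, s < r <= t -> `|g (left_lim x r) - g (x s)| <= e) ->
  `|\int[mu]_(r in `]s, t]) g (left_lim x r) - g (x s) * (q t - q s)|
    <= e * (q t - q s).
Proof.
move=> cg s0 st tT adms admt ge.
have sub : `]s, t] `<=` `]0, T].
  move=> r; rewrite /= !in_itv/= => /andP[sr rt].
  by rewrite (le_lt_trans s0)// (le_trans rt).
have mst := admissible_measure s0 st tT adms admt.
have ig : mu.-integrable `]s, t] (EFin \o (fun r => g (left_lim x r))).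
  by apply: integrableS (left_lim_integrable cg).
have ic c : mu.-integrable `]s, t] (EFin \o (fun=> c)).
  apply: measurable_bounded_integrable => //.
  - by rewrite mst ltry.
  - by exists `|c|; split; [exact: num_real|move=> k ck r _; exact: ltW].
have Ic c : \int[mu]_(r in `]s, t]) c = c * (q t - q s).
  by rewrite Rintegral_cst// mst.
have igc : mu.-integrable `]s, t]
    (EFin \o (fun r => g (left_lim x r) - g (x s))).
  exact: (integrableB _ ig (ic _)).
rewrite -!Ic -RintegralB// (le_trans (le_normr_Rintegral _ _))//.
apply: le_Rintegral => //; exact: (integrable_norm igc).
Qed.

Lemma weighted_sum_increment g p s t c e :
  {in pieces p, forall I, precedes x s I -> precedes x t I} ->
  {in pieces p, forall I, precedes x t I -> ~~ precedes x s I ->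
    `|g (x I.1) - c| <= e} ->
  `|weighted_sum x g p t - weighted_sum x g p s
    - c * (weighted_sum x (fun=> 1) p t - weighted_sum x (fun=> 1) p s)|
  <= e * (weighted_sum x (fun=> 1) p t - weighted_sum x (fun=> 1) p s).
Proof.
move=> mono ge.
have E h : weighted_sum x h p t - weighted_sum x h p s =
    \sum_(I <- pieces p | precedes x t I && ~~ precedes x s I)
      h (x I.1) * sqr_incr x I.
  rewrite /weighted_sum (bigID (precedes x s))/= addrC.
  rewrite [X in _ + X - _](_ : _ = weighted_sum x h p s) ?addrK//.
  rewrite /weighted_sum big_seq_cond [RHS]big_seq_cond; apply: eq_bigl => I.
  have [In|//] := boolP (I \in pieces p); rewrite /=.
  by case: (boolP (precedes x s I)) => [/(mono _ In) ->|]; rewrite ?andbF.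
rewrite !E !mulr_sumr -sumrB (le_trans (ler_norm_sum _ _ _))//.
rewrite big_seq_cond [leRHS]big_seq_cond; apply: ler_sum => I /and3P[In It Is].
rewrite mul1r -mulrBl normrM (ger0_norm (sqr_incr_ge0 _ _)).
by rewrite ler_wpM2r ?sqr_incr_ge0// ge.
Qed.

(** Over each step of the chain [x] is almost constant, so the weighted sum and
    the integral are both close to the same multiple of the increment of [q]; the
    error is a small multiple of this increment, and these add up to [q T]. *)
Theorem weighted_square_sum_cvg g : continuous g ->
  \sum_(I <- pieces (pi n)) g (x I.1) * (x I.2 - x I.1) ^+ 2 @[n --> \oo] -->
  \int[mu]_(t in `]0, T]) g (left_lim x t).
Proof.
move=> cg.
have [M xM] := cadlag_bounded x_cadlag T_gt0.
have [K K0 gK] := continuous_segment_bounded M cg.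
have qT0 : 0 <= q T.
  by rewrite -square_sum_limit_at0; apply: q_nd; rewrite ?in_itv/= ?lexx//= ltW.
(* The error [2 * e * q t] at [t] accumulates along the chain, each step from [s]
   to [t] adding [2 * e * (q t - q s)]: half of it comes from the sum and half
   from the integral.  The slack [d] absorbs the eventual errors. *)
suff main e : 0 < e -> forall d, 0 < d -> \forall n \near \oo,
    `|weighted_sum x g (pi n) T - \int[mu]_(t in `]0, T]) g (left_lim x t)|
      <= 2 * e * q T + d.
  apply/cvgrPdist_le => eps eps0.
  have e0 : 0 < eps / (4 * (q T + 1)) by rewrite divr_gt0// mulr_gt0// ltr_wpDl.
  have := main _ e0 (eps / 2); rewrite divr_gt0// => /(_ isT).
  apply: filterS => n.
  rewrite distrC (weighted_sum_atT _ pi_partition) => /le_trans; apply.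
  rewrite [leRHS]splitr lerD2r.
  have : eps = eps / (4 * (q T + 1)) * (4 * (q T + 1)).
    by rewrite divfK// mulf_neq0// gt_eqF// ltr_wpDl.
  by move: (eps / _) e0 => v v0 epsE; lra.
move=> e0; have [eta eta0 geta] := continuous_segment_uniform M cg e0.
apply: (cadlag_induction x_cadlag (good := admissible) (P := fun t =>
  forall d, 0 < d -> \forall n \near \oo,
    `|weighted_sum x g (pi n) t - \int[mu]_(r in `]0, t]) g (left_lim x r)|
      <= 2 * e * q t + d) (e := eta)) => //.
- exact: Or41.
- exact: Or42.
- by move=> t /andP[t0 _] jt; exact: Or43.
- exact: admissible_dense.
- move=> d d0; apply: nearW => n.
  by rewrite (weighted_sum_at0 _ pi_partition) set_itvoc0 Rintegral_set0 subrr normr0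
    square_sum_limit_at0 mulr0 add0r ltW.
move=> s t s0 st tT adms admt xst Ps d d0.
have sT : s <= T by exact: le_trans (ltW st) tT.
have t0 : 0 < t by exact: le_lt_trans st.
(* The increment of the sum of the squared increments is within [2 * d'] of that of
   [q]; it is multiplied by the weight, at most [K], and by the error [e] on it. *)
pose d' := d / (4 * (e + K)).
have eK : 0 < 4 * (e + K) by rewrite mulr_gt0// addr_gt0.
have d'0 : 0 < d' by rewrite divr_gt0.
have d20 : 0 < d / 2 by rewrite divr_gt0.
have xsM : `|x s| <= M by case: (xM s); rewrite ?s0.
have split_int : \int[mu]_(r in `]0, t]) g (left_lim x r) =
    \int[mu]_(r in `]0, s]) g (left_lim x r) +
    \int[mu]_(r in `]s, t]) g (left_lim x r).
  have -> : `]0, t]%classic = `]0, s]%classic `|` `]s, t]%classic.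
    by rewrite -itv_bndbnd_setU ?bnd_simp// ltW.
  rewrite Rintegral_setU//.
    rewrite -itv_bndbnd_setU ?bnd_simp// ?ltW//.
    apply: integrableS (left_lim_integrable cg) => //.
    by apply: subset_itvl; rewrite bnd_simp.
  by apply/disj_setPS => r [] /=; rewrite !in_itv/= => /andP[_ ?] /andP[? _]; lra.
have intst : `|\int[mu]_(r in `]s, t]) g (left_lim x r) - g (x s) * (q t - q s)|
    <= e * (q t - q s).
  apply: integral_increment => // r /andP[sr rt].
  have r0 : 0 < r by exact: le_lt_trans sr.
  have rT : r <= T by exact: le_trans tT.
  have lM : `|left_lim x r| <= M by have [|_ ->//] := xM r; rewrite ltW.
  rewrite geta//; apply: (left_lim_le x_cadlag _ sr); first by rewrite r0.
  by move=> z /andP[sz zr]; rewrite xst// ltW//= (lt_le_trans zr).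
near=> n.
have Ws : `|q s - weighted_sum x (fun=> 1) (pi n) s| <= d'.
  by near: n; apply: cvgr_dist_le => //; apply: admissible_cvg; rewrite ?s0.
have Wt : `|q t - weighted_sum x (fun=> 1) (pi n) t| <= d'.
  by near: n; apply: cvgr_dist_le => //; apply: admissible_cvg; rewrite ?(ltW t0).
have Ss : `|weighted_sum x g (pi n) s - \int[mu]_(r in `]0, s]) g (left_lim x r)|
    <= 2 * e * q s + d / 2 by near: n; exact: Ps.
have mono : {in pieces (pi n), forall I, precedes x s I -> precedes x t I}.
  by near: n; apply: (precedes_mono x_cadlag pi_partition pi_A2); rewrite ?st.
have win : {in pieces (pi n), forall I, precedes x t I -> ~~ precedes x s I ->
    `|x I.1 - x s| <= eta}.
  near: n; apply: (precedes_window pi_partition pi_A2) => //.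
  by rewrite st.
have winc := @weighted_sum_increment g (pi n) s t (g (x s)) e mono.
have {winc}winc := winc _.
have {}winc : `|weighted_sum x g (pi n) t - weighted_sum x g (pi n) s
    - g (x s) * (weighted_sum x (fun=> 1) (pi n) t -
                 weighted_sum x (fun=> 1) (pi n) s)|
  <= e * (weighted_sum x (fun=> 1) (pi n) t -
          weighted_sum x (fun=> 1) (pi n) s).
  apply: winc => I In It Is; rewrite distrC geta// distrC; exact: win.
have dE : d / 2 = (e + K) * (2 * d').
  rewrite /d'; field; by rewrite gt_eqF// addr_gt0.
move: winc intst Ss Wt Ws (gK _ xsM) split_int; rewrite dE.
move: (\int[mu]_(r in `]0, t]) _) (\int[mu]_(r in `]0, s]) _)
  (\int[mu]_(r in `]s, t]) _) (weighted_sum x g (pi n) t)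
  (weighted_sum x g (pi n) s) (weighted_sum x (fun=> 1) (pi n) t)
  (weighted_sum x (fun=> 1) (pi n) s) (g (x s)).
move=> It Is Ist St Ss Wt Ws c winc intst Ss_le Wt_le Ws_le cK ->.
have dW : `|(Wt - Ws) - (q t - q s)| <= 2 * d'.
  move: Wt_le Ws_le; rewrite !ler_norml => /andP[? ?] /andP[? ?].
  by apply/andP; split; lra.
have cdW : `|c * ((Wt - Ws) - (q t - q s))| <= K * (2 * d').
  by rewrite normrM ler_pM.
have edW : e * (Wt - Ws) <= e * (q t - q s) + e * (2 * d').
  rewrite -mulrDr; apply: ler_wpM2l; first exact: ltW.
  by move: dW; rewrite ler_norml => /andP[_ ?]; lra.
move: winc intst Ss_le cdW edW; rewrite !ler_norml.
move=> /andP[? ?] /andP[? ?] /andP[? ?] /andP[? ?] ?.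
have -> : d = (e + K) * (2 * d') + (e + K) * (2 * d') by lra.
by apply/andP; split; lra.
Unshelve. all: by end_near. Qed.

End SecondOrder.

(** * Finite families and unordered sums *)

Section FiniteFamilies.
Context {R : realType}.
Implicit Types (D F : set R) (G : seq R) (g : R -> R) (c : R).

Lemma finite_set_uniq_seq D : finite_set D ->
  exists2 G, uniq G & D = [set` G].
Proof.
move=> /finite_seqP[G ->]; exists (undup G); first exact: undup_uniq.
by apply/seteqP; split=> t /=; rewrite mem_undup.
Qed.

Lemma near_all_seq (I : eqType) (s : seq I) (P : I -> nat -> Prop) :
  {in s, forall i, \forall n \near \oo, P i n} ->
  \forall n \near \oo, {in s, forall i, P i n}.
Proof.
elim: s => [|i s IH] Ps; first exact: nearW.
have Pi : \forall n \near \oo, P i n by apply: Ps; rewrite mem_head.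
have {}IH : \forall n \near \oo, {in s, forall j, P j n}.
  by apply: IH => j js; apply: Ps; rewrite inE js orbT.
near=> n => j; rewrite inE => /predU1P[->|]; first by near: n.
by move: j; near: n.
Unshelve. all: by end_near. Qed.

Lemma sum_seq_cvg (I : Type) (s : seq I) (u : I -> nat -> R) (l : I -> R) :
  (forall i, u i n @[n --> \oo] --> l i) ->
  \sum_(i <- s) u i n @[n --> \oo] --> \sum_(i <- s) l i.
Proof.
move=> ul; elim: s => [|i s IH].
  by under eq_cvg do rewrite big_nil; rewrite big_nil; exact: cvg_cst.
under eq_cvg do rewrite big_cons; rewrite big_cons.
exact: cvgD.
Qed.

Lemma esum_le_seq D g c :
  (forall G, uniq G -> [set` G] `<=` D -> \sum_(t <- G) g t <= c) ->
  (\esum_(t in D) (g t)%:E <= c%:E)%E.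
Proof.
move=> Gc; apply: ge_ereal_sup => _ [A [/finite_set_uniq_seq[G uG ->] GD] <-].
by rewrite -fsbig_seq//= sumEFin lee_fin Gc.
Qed.

Lemma summable_le_seq D g c :
  (forall G, uniq G -> [set` G] `<=` D -> \sum_(t <- G) `|g t| <= c) ->
  summable D (fun t => (g t)%:E).
Proof. by move=> Gc; rewrite /summable (le_lt_trans (esum_le_seq Gc))// ltry. Qed.

Lemma esum_finite_tail D F g c : finite_set F -> F `<=` D ->
  (forall t, 0 <= g t) ->
  (forall G, uniq G -> [set` G] `<=` D `\` F -> \sum_(t <- G) g t <= c) ->
  exists2 d, 0 <= d <= c &
    (\esum_(t in D) (g t)%:E = (\sum_(t \in F) g t + d)%:E)%E.
Proof.
move=> finF FD g0 Gc.
have t0 : (0 <= \esum_(t in D `\` F) (g t)%:E)%E.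
  by apply: esum_ge0 => t _; rewrite lee_fin.
have tc := esum_le_seq Gc.
have tfin : (\esum_(t in D `\` F) (g t)%:E)%E \is a fin_num.
  by rewrite ge0_fin_numE// (le_lt_trans tc)// ltry.
exists (fine (\esum_(t in D `\` F) (g t)%:E)%E).
  by rewrite fine_ge0//= -lee_fin fineK.
rewrite (esumID F); last by move=> t _; rewrite lee_fin.
rewrite -setDE EFinD fineK//; congr (_ + _)%E.
have /setIidr -> := FD.
rewrite esum_fset//; last by move=> t _; rewrite lee_fin.
by have [G uG ->] := finite_set_uniq_seq finF; rewrite -!fsbig_seq//= sumEFin.
Qed.

(** The tails of the sums of the positive and negative parts both lie in [0, c],
    so the error of the difference is at most [c], not [2 * c]. *)
Lemma sum_over_approx D G g c : uniq G -> [set` G] `<=` D ->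
  (forall H, uniq H -> [set` H] `<=` D `\` [set` G] ->
    \sum_(t <- H) `|g t| <= c) ->
  `|\sum_(t <- G) g t - sum_over D g| <= c.
Proof.
move=> uG GD Hc.
have [|||p /andP[p0 pc] pE] := @esum_finite_tail D [set` G] g^\+ c _ GD.
- exact: finite_seq.
- by move=> t; rewrite le_max lexx orbT.
- move=> H uH HD; apply: le_trans (Hc H uH HD); apply: ler_sum => t _.
  by rewrite ge_max ler_norm normr_ge0.
have [|||m /andP[m0 mc] mE] := @esum_finite_tail D [set` G] g^\- c _ GD.
- exact: finite_seq.
- by move=> t; rewrite le_max lexx orbT.
- move=> H uH HD; apply: le_trans (Hc H uH HD); apply: ler_sum => t _.
  by rewrite ge_max -normrN ler_norm normr_ge0.
rewrite /sum_over pE mE -EFinB/= -!fsbig_seq//=.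
rewrite [X in `|X - _|](_ : _ = \sum_(t <- G) g^\+ t - \sum_(t <- G) g^\- t).
  by rewrite ler_norml; apply/andP; split; lra.
by rewrite -sumrB; apply: eq_bigr => t _; rewrite -[in LHS](funrposBneg g).
Qed.

End FiniteFamilies.

(** * Jumps and Taylor remainders *)

Section LimsupNear.
Context {R : realType}.

Lemma limf_esup_lt_near (U : choiceType) (X : filteredType U)
    (F : set_system X) (FF : Filter F) (h : X -> \bar R) (y : \bar R) :
  (limf_esup h F < y)%E -> \forall a \near F, (h a < y)%E.
Proof.
move=> /ereal_inf_lt[_ [V FV <-] supV]; apply: filterS FV => a Va.
by apply: le_lt_trans supV; apply: ereal_sup_ubound; exists a.
Qed.

End LimsupNear.

Section JumpRemainder.
Context {R : realType}.
Variables (T : R) (x : R -> R) (pi : nat -> seq R) (Q : R).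
Hypothesis T_gt0 : 0 < T.
Hypothesis x_cadlag : cadlag T x.
Hypothesis pi_partition : forall n, itv_partition 0 T (pi n).
Hypothesis pi_A1 : A1 T x pi.
Hypothesis pi_A2 : A2 T x pi.
Hypothesis sqr_cvg :
  \sum_(I <- pieces (pi n)) sqr_incr x I @[n --> \oo] --> Q.
Implicit Types (G : seq R) (I : R * R) (e d : R).

Lemma all_jumpsP t : all_jumps T x t <-> 0 < t <= T /\ jump x t != 0.
Proof. by rewrite /all_jumps/= normr_gt0. Qed.

Lemma jump_pieces_uniq G : uniq G -> [set` G] `<=` all_jumps T x ->
  \forall n \near \oo, uniq (map (piece_at (pi n)) G).
Proof.
elim: G => [|r G IH]; first by move=> *; exact: nearW.
move=> /= /andP[rG uG] GJ.
have /all_jumpsP[rT jr] : all_jumps T x r by apply: GJ; rewrite /= mem_head.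
have {}IH : \forall n \near \oo, uniq (map (piece_at (pi n)) G).
  by apply: IH => // t tG; apply: GJ; rewrite /= inE [_ \in _]tG orbT.
have sep s t : 0 < s <= T -> jump x s != 0 -> s < t <= T ->
    \forall n \near \oo, piece_at (pi n) s != piece_at (pi n) t.
  move=> /andP[s0 sT] js /andP[st tT].
  near=> n; apply/negP => /eqP same.
  have tT' : 0 < t <= T by rewrite tT (lt_trans s0).
  have [_ /andP[_]] := piece_at_mem (pi_partition n) tT'.
  rewrite -same leNgt => /negP; apply; near: n.
  by apply: (jump_piece_separated x_cadlag pi_partition pi_A2); rewrite ?st.
have dist : \forall n \near \oo, {in G, forall t,
    piece_at (pi n) r != piece_at (pi n) t}.
  apply: near_all_seq => t tG.
  have /all_jumpsP[tT jt] : all_jumps T x t.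
    by apply: GJ; rewrite /= inE [_ \in _]tG orbT.
  have [rt|tr|rt] := ltgtP r t.
  - by apply: sep => //; rewrite rt; case/andP: tT.
  - have : \forall n \near \oo, piece_at (pi n) t != piece_at (pi n) r.
      by apply: sep => //; rewrite tr; case/andP: rT.
    by apply: filterS => n; rewrite eq_sym.
  - by rewrite rt tG in rG.
near=> n; apply/andP; split; last by near: n.
apply/negP => /mapP[t tG rt].
have : {in G, forall t, piece_at (pi n) r != piece_at (pi n) t} by near: n.
by move=> /(_ t tG); rewrite rt eqxx.
Unshelve. all: by end_near. Qed.

Lemma sum_jump_pieces (V : nmodType) (h : R * R -> V) n G :
  uniq (map (piece_at (pi n)) G) -> [set` G] `<=` all_jumps T x ->
  \sum_(I <- pieces (pi n) | I \in map (piece_at (pi n)) G) h I =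
  \sum_(t <- G) h (piece_at (pi n) t).
Proof.
move=> uG GJ; rewrite -(big_map (piece_at (pi n)) xpredT h) -[LHS]big_filter.
apply: perm_big; apply: uniq_perm => //.
  by rewrite filter_uniq// (pieces_uniq (pi_partition n)).
move=> I; rewrite mem_filter; have [/mapP[t tG ->]|//] := boolP (I \in map _ _).
have /all_jumpsP[tT _] := GJ t tG.
by have [-> _] := piece_at_mem (pi_partition n) tT.
Qed.

(** The jumps in [G] eventually contribute to the squared increments through
    distinct pieces. *)
Lemma sum_jump_sqr_le G : uniq G -> [set` G] `<=` all_jumps T x ->
  \sum_(t <- G) jump x t ^+ 2 <= Q.
Proof.
move=> uG GJ.
have jcvg : \sum_(t <- G) sqr_incr x (piece_at (pi n) t) @[n --> \oo] -->
    \sum_(t <- G) jump x t ^+ 2.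
  rewrite big_seq; under eq_cvg do rewrite big_seq big_mkcond; rewrite big_mkcond.
  apply: sum_seq_cvg => t; case: ifP => [tG|_]; last exact: cvg_cst.
  have /all_jumpsP[tT jt] := GJ t tG.
  exact: (jump_sqr_incr_cvg x_cadlag pi_partition pi_A2).
apply: (ler_cvg_to jcvg sqr_cvg); near=> n.
have uGn : uniq (map (piece_at (pi n)) G) by near: n; exact: jump_pieces_uniq.
rewrite -(sum_jump_pieces (sqr_incr x) uGn GJ) big_mkcond.
by apply: ler_sum => I _; case: ifP => // _; exact: sqr_incr_ge0.
Unshelve. all: by end_near. Qed.

Lemma big_jumps_sub e : 0 < e -> big_jumps T x e `<=` all_jumps T x.
Proof. by move=> e0 t [tT et]; split => //; exact: lt_le_trans et. Qed.

(** Each of these jumps contributes at least [e ^+ 2] to a sum bounded by [Q]. *)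
Lemma big_jumps_finite e : 0 < e -> finite_set (big_jumps T x e).
Proof.
move=> e0; apply: contrapT => inf.
have [B BJ kB] := infinite_set_fset (Num.truncn (Q / e ^+ 2)).+1 inf.
have : \sum_(t <- finmap.enum_fset B) jump x t ^+ 2 <= Q.
  apply: sum_jump_sqr_le; first exact: finmap.fset_uniq.
  by move=> t tB; apply: (big_jumps_sub e0); exact: BJ.
rewrite leNgt => /negP; apply.
have : \sum_(t <- finmap.enum_fset B) e ^+ 2 <=
    \sum_(t <- finmap.enum_fset B) jump x t ^+ 2.
  rewrite big_seq [leRHS]big_seq; apply: ler_sum => t tB.
  have [_ et] := BJ t tB.
  by rewrite -(real_normK (num_real (jump x t))) lerXn2r ?nnegrE// ltW.
apply: lt_le_trans; rewrite big_const_seq count_predT iter_addr_0 -mulr_natr.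
rewrite mulrC -ltr_pdivrMr ?exprn_gt0//.
by rewrite (lt_le_trans (truncnS_gt _))// ler_nat.
Qed.

(** Without big jumps in ]u, v], the big-jump part is constant there, so the
    oscillation bounds the variation of [x] on ]u, v].  This ignores the value at
    [u], which is recovered by right continuity. *)
Lemma piece_incr_le n e d I : I \in pieces (pi n) ->
  (max_oscillation (x \- jump_part T x e)%R (pi n) < d%:E)%E ->
  (forall t, I.1 < t <= I.2 -> ~ big_jumps T x e t) ->
  `|x I.2 - x I.1| <= d.
Proof.
move=> In osc nojump; have [I1 I12 I2] := mem_pieces (pi_partition n) In.
have near_right s : I.1 < s <= I.2 -> `|x I.2 - x s| <= d.
  move=> /andP[I1s sI2].
  have Jeq : jump_part T x e I.2 = jump_part T x e s.
    rewrite /jump_part; congr (\sum_(r \in _) _); apply/seteqP; split=> r [Jr] /=.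
      rewrite !in_itv/= => /andP[-> rI2]; split => //=; rewrite leNgt.
      by apply/negP => sr; apply: (nojump r) => //; rewrite (lt_trans I1s sr).
    by rewrite !in_itv/= => /andP[-> rs]; split => //=; rewrite (le_trans rs).
  have oscI : (oscillation (x \- jump_part T x e)%R `]I.1, I.2] <= d%:E)%E.
    apply: (le_trans _ (ltW osc)); rewrite /max_oscillation.
    exact: (@le_bigmax_seq _ _ _ _ _ I xpredT
      (fun J => oscillation (x \- jump_part T x e)%R `]J.1, J.2])).
  rewrite -lee_fin (le_trans _ oscI)//; apply: ereal_sup_ubound.
  exists (s, I.2); first by split; rewrite /= in_itv/= ?I1s ?I12 ?lexx.
  by rewrite /= Jeq; congr (`|_|%:E); ring.
have [xr _] := x_cadlag.
have lim : `|x I.2 - x s| @[s --> I.1^'+] --> `|x I.2 - x I.1|.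
  apply: cvg_norm; apply: cvgB; first exact: cvg_cst.
  by apply: xr; rewrite I1 (lt_le_trans I12 I2).
apply: (cvgr_to_le lim); near=> s; apply: near_right; apply/andP; split.
  by near: s; exact: nbhs_right_gt.
by near: s; exact: nbhs_right_le.
Unshelve. all: by end_near. Qed.

Variable f : R -> R.
Hypothesis f_C2 : C2 f.

Lemma ito_jump_termE t :
  ito_jump_term f x t = taylor_remainder f (left_lim x t) (x t).
Proof. by []. Qed.

Lemma taylor_remainder_cvg (u v : nat -> R) (a b : R) :
  u n @[n --> \oo] --> a -> v n @[n --> \oo] --> b ->
  taylor_remainder f (u n) (v n) @[n --> \oo] --> taylor_remainder f a b.
Proof.
have [df d2f cf2] := f_C2.
have cont (h : R -> R) : (forall y, derivable h y 1) -> continuous h.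
  by move=> dh y; apply: differentiable_continuous; exact/derivable1_diffP.
move=> ua vb; rewrite /taylor_remainder.
have vu : v n - u n @[n --> \oo] --> b - a by exact: cvgB.
have fu := cvg_comp _ _ ua (cont _ df a).
have fv := cvg_comp _ _ vb (cont _ df b).
have f1u := cvg_comp _ _ ua (cont _ d2f a).
have f2u := cvg_comp _ _ ua (cf2 a).
rewrite expr2; under eq_cvg do rewrite expr2.
apply: cvgB; first apply: cvgB; first exact: cvgB.
  exact: cvgM.
apply: cvgM; last exact: cvgM.
by apply: cvgM => //; exact: cvg_cst.
Qed.

Let x_bounded : exists M, forall t, 0 <= t <= T ->
  `|x t| <= M /\ (0 < t -> `|left_lim x t| <= M).
Proof. exact: cadlag_bounded. Qed.

Let Q_ge0 : 0 <= Q.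
Proof.
by have := @sum_jump_sqr_le [::]; rewrite big_nil; apply => // t.
Qed.

Lemma ito_jump_term_summable :
  summable (all_jumps T x) (fun t => (ito_jump_term f x t)%:E).
Proof.
have [_ _ cf2] := f_C2; have [M xM] := x_bounded.
have [K K0 fK] := continuous_segment_bounded M cf2.
apply: (@summable_le_seq _ _ _ (2 * K * Q)) => G uG GJ.
apply: (@le_trans _ _ (\sum_(t <- G) 2 * K * jump x t ^+ 2)); last first.
  by rewrite -mulr_sumr ler_wpM2l ?mulr_ge0 ?(ltW K0)// sum_jump_sqr_le.
rewrite big_seq [leRHS]big_seq; apply: ler_sum => t tG.
have /all_jumpsP[/andP[t0 tT] _] := GJ t tG.
have [|xtM /(_ t0) ltM] := xM t; first by rewrite ltW.
rewrite ito_jump_termE; apply: taylor_remainder_le => // c ac.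
have cM : `|c| <= M.
  move: ac xtM ltM; rewrite minEle maxEle !ler_norml.
  by case: ifPn => _ /andP[? ?] /andP[? ?] /andP[? ?]; apply/andP; split; lra.
rewrite (le_trans (ler_normB _ _))//.
by rewrite mulr_natl mulr2n lerD// fK.
Qed.

(** The jumps of size at least [c] sit in distinct pieces, whose remainders
    converge to those of the jumps.  Over every other piece [x] moves by at most
    [d], so that the remainder is at most [e] times the squared increment; and
    the remainders of the jumps smaller than [c <= d] are at most [e] times the
    squared jumps. *)
Lemma taylor_remainder_sum_cvg :
  \sum_(I <- pieces (pi n)) taylor_remainder f (x I.1) (x I.2)
    @[n --> \oo] --> sum_over (all_jumps T x) (ito_jump_term f x).
Proof.
have [_ _ cf2] := f_C2; have [M xM] := x_bounded.
apply/cvgrPdist_le => eps eps0.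
(* Three errors: [e * Q] from the small jumps, [e * (Q + 1)] from the pieces without
   big jumps, and [eps / 4] from the big jumps. *)
pose e := eps / (4 * (Q + 1)).
have Q1 : 0 < Q + 1 by rewrite ltr_wpDl.
have e0 : 0 < e by rewrite divr_gt0// mulr_gt0.
have [d d0 fd] := continuous_segment_uniform M cf2 e0.
have small a b : `|a| <= M -> `|b - a| <= d ->
    `|taylor_remainder f a b| <= e * (b - a) ^+ 2.
  move=> aM ab; apply: taylor_remainder_le => // c.
  rewrite minEle maxEle => cab; rewrite distrC fd//; move: cab ab.
  rewrite !ler_norml; case: ifPn => ? /andP[? ?] /andP[? ?];
    by apply/andP; split; lra.
have [c [/= c0 cd osc]] : exists c, [/\ 0 < c, c <= d &
    \forall n \near \oo, (max_oscillation (x \- jump_part T x c)%R (pi n) < d%:E)%E].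
  have lim : \forall c \near 0^'+, (limn_esup (fun n =>
      max_oscillation (x \- jump_part T x c)%R (pi n)) < d%:E)%E.
    by apply: limf_esup_lt_near; rewrite pi_A1 lte_fin.
  near (0 : R)^'+ => c; exists c; split => //.
    by near: c; exact: nbhs_right_le.
  have limc : (limn_esup (fun n =>
      max_oscillation (x \- jump_part T x c)%R (pi n)) < d%:E)%E by near: c.
  exact: (limf_esup_lt_near _ limc).
have [G uG GE] := finite_set_uniq_seq (big_jumps_finite c0).
have GJ : [set` G] `<=` all_jumps T x by rewrite -GE; exact: big_jumps_sub.
have tail : `|\sum_(t <- G) ito_jump_term f x t
    - sum_over (all_jumps T x) (ito_jump_term f x)| <= e * Q.
  apply: sum_over_approx => // H uH HJ.
  have HJ' : [set` H] `<=` all_jumps T x by move=> t /HJ[].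
  apply: (@le_trans _ _ (\sum_(t <- H) e * jump x t ^+ 2)); last first.
    by rewrite -mulr_sumr ler_wpM2l ?(ltW e0)// sum_jump_sqr_le.
  rewrite big_seq [leRHS]big_seq; apply: ler_sum => t tH.
  have [/all_jumpsP[/andP[t0 tT] _] tG] := HJ t tH.
  have [|_ /(_ t0) ltM] := xM t; first by rewrite ltW.
  rewrite ito_jump_termE; apply: small => //.
  rewrite leNgt; apply/negP => dt; apply: tG; rewrite -GE.
  by split; [rewrite t0|exact: le_trans cd (ltW dt)].
have jcvg : \sum_(t <- G) taylor_remainder f (x (piece_at (pi n) t).1)
      (x (piece_at (pi n) t).2) @[n --> \oo] --> \sum_(t <- G) ito_jump_term f x t.
  rewrite big_seq; under eq_cvg do rewrite big_seq big_mkcond; rewrite big_mkcond.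
  apply: sum_seq_cvg => t; case: ifP => [tG|_]; last exact: cvg_cst.
  have /all_jumpsP[tT jt] := GJ t tG.
  apply: taylor_remainder_cvg; first exact: pi_A2.
  exact: (jump_right_endpoint_cvg x_cadlag pi_partition pi_A2).
have e40 : 0 < eps / 4 by rewrite divr_gt0.
near=> n.
have uGn : uniq (map (piece_at (pi n)) G) by near: n; exact: jump_pieces_uniq.
have jn : `|\sum_(t <- G) ito_jump_term f x t -
    \sum_(t <- G) taylor_remainder f (x (piece_at (pi n) t).1)
      (x (piece_at (pi n) t).2)| <= eps / 4.
  by near: n; exact: cvgr_dist_le.
have Qn : \sum_(I <- pieces (pi n)) sqr_incr x I <= Q + 1.
  by near: n; apply: cvgr_le sqr_cvg _ _; rewrite ltrDl.
have oscn : (max_oscillation (x \- jump_part T x c)%R (pi n) < d%:E)%E by near: n.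
rewrite (bigID (mem (map (piece_at (pi n)) G)))/=.
rewrite (sum_jump_pieces (fun I => taylor_remainder f (x I.1) (x I.2)) uGn GJ).
have rest : `|\sum_(I <- pieces (pi n) | I \notin map (piece_at (pi n)) G)
    taylor_remainder f (x I.1) (x I.2)| <= e * (Q + 1).
  apply: (@le_trans _ _ (\sum_(I <- pieces (pi n)) e * sqr_incr x I)); last first.
    by rewrite -mulr_sumr ler_wpM2l ?(ltW e0).
  rewrite (le_trans (ler_norm_sum _ _ _))// big_mkcond big_seq [leRHS]big_seq.
  apply: ler_sum => I In; case: ifPn => [IG|_]; last first.
    by rewrite mulr_ge0 ?(ltW e0)// sqr_incr_ge0.
  have [I1 I12 I2] := mem_pieces (pi_partition n) In.
  have [|xI1 _] := xM I.1; first by rewrite I1 (le_trans (ltW I12)).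
  apply: small => //; apply: (piece_incr_le In oscn) => t It.
  rewrite GE => tG; move/negP: IG; apply; apply/mapP; exists t => //.
  by rewrite (piece_at_eq (pi_partition n) In It).
have epsE : eps = e * (4 * (Q + 1)) by rewrite /e divfK// gt_eqF// mulr_gt0.
have e1 : 0 <= e * Q by rewrite mulr_ge0// ltW.
move: tail jn rest; rewrite epsE !ler_norml => /andP[? ?] /andP[? ?] /andP[? ?].
by apply/andP; split; lra.
Unshelve. all: by end_near. Qed.

End JumpRemainder.

(** * The Itô-Föllmer formula *)

Theorem corollary1 (R : realType) (T : R) (T_gt0 : 0 < T)
  (x : R -> R) (x_cadlag : cadlag T x)
  (pi : nat -> seq R) (pi_partition : forall n, itv_partition 0 T (pi n))
  (pi_A1 : A1 T x pi) (pi_A2 : A2 T x pi)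
  (q : R -> R)
  (q_ge0 : forall t, 0 <= t <= T -> 0 <= q t)
  (q_nd : {in `[0, T] &, {homo q : a b / a <= b}})
  (q_lim : forall t, 0 <= t <= T ->
     [\/ continuous_on_at T q t, t = T | 0 < t /\ jump x t != 0] ->
     square_sum x (pi n) t @[n --> \oo] --> q t)
  (q_rc : forall t, 0 < t < T -> jump x t != 0 -> q s @[s --> t^'+] --> q t)
  (* needed: see the remark after [rc_mod_measure_itv] *)
  (q_rc0 : q s @[s --> 0^'+] --> q 0)
  (f : R -> R) (f_C2 : C2 f) :
  let mu := rc_mod_measure T_gt0 q_nd in
  [/\ mu.-integrable `]0, T]
        (fun t => (derive1n 2 f (left_lim x t))%:E),
      second_order_sum f x (pi n) @[n --> \oo] -->
        \int[mu]_(t in `]0, T]) derive1n 2 f (left_lim x t),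
      cvgn (fun n => first_order_sum f x (pi n)),
      summable (all_jumps T x) (fun t => (ito_jump_term f x t)%:E)
    & f (x T) - f (x 0) =
        follmer_integral f x pi
        + 2^-1 * \int[mu]_(t in `]0, T]) derive1n 2 f (left_lim x t)
        + sum_over (all_jumps T x) (ito_jump_term f x)].
Proof.
move=> mu; have [_ _ cf2] := f_C2.
have sqr_cvg : \sum_(I <- pieces (pi n)) sqr_incr x I @[n --> \oo] --> q T.
  have TT : 0 < T <= T by rewrite T_gt0 lexx.
  have := weighted_sum1_cvg x_cadlag pi_partition pi_A2 TT
    (q_lim T _ (Or32 _ _ erefl)).
  rewrite lexx ltW// => /(_ isT).
  under eq_cvg => n.
    rewrite weighted_sum_atT//; under eq_bigr do rewrite mul1r; over.
  by [].
have second : second_order_sum f x (pi n) @[n --> \oo] -->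
    \int[mu]_(t in `]0, T]) derive1n 2 f (left_lim x t).
  exact: weighted_square_sum_cvg.
have remainder := taylor_remainder_sum_cvg T_gt0 x_cadlag pi_partition pi_A1
  pi_A2 sqr_cvg f_C2.
have firstE n : first_order_sum f x (pi n) = f (x T) - f (x 0)
    - 2^-1 * second_order_sum f x (pi n)
    - \sum_(I <- pieces (pi n)) taylor_remainder f (x I.1) (x I.2).
  rewrite -(pieces_telescope (pi_partition n) (fun t => f (x t))).
  rewrite /first_order_sum /second_order_sum mulr_sumr -!sumrB.
  by apply: eq_bigr => I _; rewrite /taylor_remainder; ring.
have first_cvg : first_order_sum f x (pi n) @[n --> \oo] -->
    f (x T) - f (x 0)
    - 2^-1 * \int[mu]_(t in `]0, T]) derive1n 2 f (left_lim x t)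
    - sum_over (all_jumps T x) (ito_jump_term f x).
  under eq_cvg do rewrite firstE.
  apply: cvgB remainder; apply: cvgB; first exact: cvg_cst.
  by apply: cvgM second; exact: cvg_cst.
split => //.
- exact: (left_lim_integrable T_gt0 x_cadlag pi_partition pi_A2 q_nd q_rc q_rc0
    cf2).
- by apply/cvg_ex; eexists; exact: first_cvg.
- exact: (ito_jump_term_summable T_gt0 x_cadlag pi_partition pi_A2 sqr_cvg).
- by rewrite /follmer_integral (cvg_lim _ first_cvg)//; ring.
Qed.
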